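(* Let $n\ge 3$ and $\mathbf{1}_n=(1,\dots,1)\in(S^1)^n$. Then the topological order complex $\Delta\{\mathbf{x}\in\mathbf{1}_n^\perp : x_n=1\}$ is a $(2n-4)$-ball.
   Context: The tropical phase hyperfield $\Phi$ is $S^1\cup\{0\}\subset\mathbb{C}$ with complex multiplication and multivalued addition $\boxplus$: $x\boxplus 0=\{x\}$; $x\boxplus(-x)=S^1\cup\{0\}$ for $x\neq 0$; for $x,y\in S^1$, $y\neq -x$, $x\boxplus y$ is the smallest closed arc of $S^1$ joining $x$ and $y$; iterated sums $x_1\boxplus\cdots\boxplus x_n=\bigcup\{w\boxplus x_n: w\in x_1\boxplus\cdots\boxplus x_{n-1}\}$. $\mathbf{1}_n^\perp=\{\mathbf{x}\in\Phi^n: 0\in x_1\boxplus\cdots\boxplus x_n\}$. $\Phi$ has the subspace topology from $\mathbb{C}$ and the order whose only nontrivial relations are $0<x$ for $x\in S^1$; $\Phi^n$ has the product topology and componentwise order, and $\{\mathbf{x}\in\mathbf{1}_n^\perp: x_n=1\}$ the induced topology and order. For a topological poset $\mathcal{P}$ (Hausdorff space with partial order whose graph is closed in $\mathcal{P}^2$), $\Delta(\mathcal{P})$ is the geometric realization $\bigl(\bigsqcup_{k\ge0}N_k(\mathcal{P})\times\Delta^k\bigr)/\!\sim$ of the simplicial space $N_k(\mathcal{P})=\{(x_0,\dots,x_k)\in\mathcal{P}^{k+1}:x_0\le\cdots\le x_k\}$ with face maps deleting and degeneracies repeating entries. *)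

(* Defs.v *)
From HB Require Import structures.
Set Warnings "-notation-overridden,-ambiguous-paths,-redundant-canonical-projection,-notation-incompatible-prefix".
From Stdlib Require Import Relations.
From mathcomp Require Import all_boot all_order all_algebra complex.
From mathcomp Require Import all_classical all_reals topology normedtype trigo.
Set Implicit Arguments.
Unset Strict Implicit.
Unset Printing Implicit Defensive.
Import Order.TTheory GRing.Theory Num.Theory.
Import numFieldNormedType.Exports.
Local Open Scope classical_set_scope.
Local Open Scope ring_scope.
Local Open Scope complex_scope.
Local Open Scope quotient_scope.

HB.mixin Record isTopPOrder d T of Topological T & Order.POrder d T := {
  top_porder_hausdorff : hausdorff_space T;
  top_porder_closed : closed [set p : T * T | (p.1 <= p.2)%O]
}.
#[short(type="topPOrderType")]
HB.structure Definition TopPOrder d :=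
  {T of Topological T & Order.POrder d T & isTopPOrder d T}.

Lemma diagonal_closed (T : topologicalType) :
  hausdorff_space T -> closed [set p : T * T | p.1 = p.2].
Proof.
move=> hT [x y] /= clxy; apply: hT => U V Ux Vy.
have UV : nbhs (x, y) (U `*` V) by exists (U, V).
by have [[z w] [/= <- [Uz Vz]]] := clxy _ UV; exists z.
Qed.

Section products.
Context (I : eqType) (d : Order.disp_t) (T : topPOrderType d).
Local Notation P := {ptws I -> T}.

Lemma ptws_hausdorff : hausdorff_space P.
Proof.
by apply: (@hausdorff_product I (fun=> T)) => _; exact: top_porder_hausdorff.
Qed.

Lemma ptws_le_closed : closed [set p : P * P | (p.1 <= p.2)%O].
Proof.
rewrite [X in closed X](_ : _ = \bigcap_(i in [set: I])
   (fun p : P * P => (p.1 i, p.2 i)) @^-1` [set q : T * T | (q.1 <= q.2)%O]).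
  apply: closed_bigI => i _; apply: preimage_closed; last exact: top_porder_closed.
  move=> p _; apply: cvg_pair => /=.
    apply: (@cvg_comp _ _ _ fst (fun x : P => x i)); first exact: cvg_fst.
    exact: (@proj_continuous _ _ i p.1).
  apply: (@cvg_comp _ _ _ snd (fun x : P => x i)); first exact: cvg_snd.
  exact: (@proj_continuous _ _ i p.2).
apply/seteqP; split => -[x y] /=; first by move=> /lefP xy i _; exact: xy.
by move=> xy; apply/lefP => i; exact: xy.
Qed.

HB.instance Definition _ := Order.POrder.copy P (I -> T).
HB.instance Definition _ := isTopPOrder.Build _ P ptws_hausdorff ptws_le_closed.
End products.

Section subspaces.
Context (d : Order.disp_t) (T : topPOrderType d) (A : set T).

Definition induced_le (x y : set_type A) : bool := (val x <= val y)%O.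

Lemma induced_le_refl : reflexive induced_le.
Proof. by move=> x; exact: lexx. Qed.

Lemma induced_le_anti : antisymmetric induced_le.
Proof. by move=> x y /le_anti/val_inj. Qed.

Lemma induced_le_trans : transitive induced_le.
Proof. by move=> y x z; exact: le_trans. Qed.

HB.instance Definition _ := Order.Le_isPOrder.Build d (set_type A)
  induced_le_refl induced_le_anti induced_le_trans.

Lemma set_type_hausdorff : hausdorff_space (set_type A).
Proof.
move=> x y xy; apply: val_inj; apply: top_porder_hausdorff.
move=> U V Ux Vy.
have [z [Uz Vz]] : (val @^-1` U : set A) `&` (val @^-1` V) !=set0.
  by apply: xy; exact: (@initial_continuous A T val).
by exists (val z).
Qed.

Lemma set_type_le_closed :
  closed [set p : set_type A * set_type A | (p.1 <= p.2)%O].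
Proof.
rewrite [X in closed X](_ : _ = (fun p : A * A => (val p.1, val p.2)) @^-1`
   [set q : T * T | (q.1 <= q.2)%O]) //.
apply: preimage_closed; last exact: top_porder_closed.
move=> p _; apply: cvg_pair => /=.
  apply: (@cvg_comp _ _ _ fst (val : A -> T)); first exact: cvg_fst.
  exact: (@initial_continuous A T val).
apply: (@cvg_comp _ _ _ snd (val : A -> T)); first exact: cvg_snd.
exact: (@initial_continuous A T val).
Qed.
HB.instance Definition _ :=
  isTopPOrder.Build _ (set_type A) set_type_hausdorff set_type_le_closed.
End subspaces.

(* The topology of the complex modulus; the library provides it on [R[i]^o]. *)
HB.instance Definition _ (R : rcfType) := PseudoPointedMetric.copy R[i] R[i]^o.

Section phase.
Context (R : realType).

Definition phase_set : set R[i] := [set z | z = 0 \/ `|z| = 1].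
Definition phase : Type := set_type phase_set.
HB.instance Definition _ := Topological.on phase.
HB.instance Definition _ := SubType.on phase.

Lemma phase0_subproof : 0 \in phase_set.
Proof. by rewrite inE; left. Qed.
Definition phase0 : phase := SigSub phase0_subproof.

Lemma phase1_subproof : 1 \in phase_set.
Proof. by rewrite inE; right; rewrite normr1. Qed.
Definition phase1 : phase := SigSub phase1_subproof.

Definition phase_le (x y : phase) : bool := (x == y) || (x == phase0).

Lemma phase_le_refl : reflexive phase_le.
Proof. by move=> x; rewrite /phase_le eqxx. Qed.

Lemma phase_le_anti : antisymmetric phase_le.
Proof.
move=> x y; rewrite /phase_le => /andP[/predU1P[//|/eqP->]].
by case/predU1P => [->|/eqP->].
Qed.

Lemma phase_le_trans : transitive phase_le.
Proof.
move=> y x z; rewrite /phase_le => /predU1P[->//|/eqP-> _].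
by rewrite eqxx orbT.
Qed.

HB.instance Definition _ := Order.Le_isPOrder.Build Order.default_display phase
  phase_le_refl phase_le_anti phase_le_trans.

Lemma phase_hausdorff : hausdorff_space phase.
Proof.
move=> x y xy; apply: val_inj; apply: (@norm_hausdorff _ R[i]^o).
move=> U V Ux Vy.
have [z [Uz Vz]] : (val @^-1` U : set phase) `&` (val @^-1` V) !=set0.
  by apply: xy; exact: (@initial_continuous phase_set R[i] val).
by exists (val z).
Qed.

Lemma phase_le_closed : closed [set p : phase * phase | (p.1 <= p.2)%O].
Proof.
rewrite [X in closed X](_ : _ = [set p : phase * phase | p.1 = p.2] `|`
   fst @^-1` [set phase0]).
  apply: closedU.
    exact: diagonal_closed phase_hausdorff.
  apply: preimage_closed; first by move=> p _; exact: cvg_fst.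
  exact: accessible_closed_set1 (hausdorff_accessible phase_hausdorff) _.
apply/seteqP; split => -[x y] /=.
   by move=> /predU1P[|/eqP]; [left|right].
by move=> [->|->]; rewrite ?lexx // /Order.le/= /phase_le eqxx orbT.
Qed.

HB.instance Definition _ := isTopPOrder.Build _ phase phase_hausdorff phase_le_closed.

Definition cis (t : R) : R[i] := cos t +i* sin t.

Definition closed_arc (a b : R) : set R[i] := [set cis t | t in [set t | a <= t <= b]].

Definition arc_joins (a b : R) (x y : R[i]) : Prop :=
  a <= b /\ (cis a = x /\ cis b = y \/ cis a = y /\ cis b = x).

(* For distinct x, y the two arcs joining x and y are not comparable for
   inclusion, so that "smallest" refers to their length. *)
Definition smallest_arc (x y : R[i]) : set R[i] :=
  [set z | exists a b : R, [/\ arc_joins a b x y,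
     forall a' b', arc_joins a' b' x y -> b - a <= b' - a' & closed_arc a b z]].

Definition phase_add (x y : phase) : set phase :=
  if y == phase0 then [set x]
  else if x == phase0 then [set y]
  else if val y == - val x then [set: phase]
  else [set z | smallest_arc (val x) (val y) (val z)].

(* The value on the empty sequence is a convention. *)
Definition phase_sum (s : seq phase) : set phase :=
  if s is x :: s' then
    foldl (fun A y => \bigcup_(w in A) phase_add w y) [set x] s'
  else [set phase0].

Definition ones_perp (n : nat) : set {ptws 'I_n -> phase} :=
  [set x | phase_sum [seq x i | i <- enum 'I_n] phase0].
End phase.
Arguments ones_perp : clear implicits.

Section simplicial_maps.
Context (R : realType) (d : Order.disp_t) (T : topPOrderType d).

Definition nerve_set (k : nat) : set {ptws 'I_k.+1 -> T} :=
  [set x | forall i j : 'I_k.+1, (i <= j)%N -> (x i <= x j)%O].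
Arguments nerve_set : clear implicits.
Definition nerve (k : nat) : Type := set_type (nerve_set k).
HB.instance Definition _ k := Topological.on (nerve k).
HB.instance Definition _ k := SubType.on (nerve k).

Definition simplex_set (k : nat) : set {ptws 'I_k.+1 -> R} :=
  [set t | (forall i, 0 <= t i) /\ \sum_i t i = 1].
Arguments simplex_set : clear implicits.
Definition simplex (k : nat) : Type := set_type (simplex_set k).
HB.instance Definition _ k := Topological.on (simplex k).
HB.instance Definition _ k := SubType.on (simplex k).

(* [lift i] is the coface map missing [i], and [codegen i] is the monotone
   surjection hitting [i] twice. *)
Definition codegen k (i : 'I_k.+1) (j : 'I_k.+2) : 'I_k.+1 :=
  inord (unbump i j).

Lemma lift_homo k (i : 'I_k.+2) :
  {homo (lift i : 'I_k.+1 -> 'I_k.+2) : j l / (j <= l)%N}.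
Proof. by move=> j l jl; rewrite /= leq_bump2. Qed.

Lemma codegenE k (i : 'I_k.+1) (j : 'I_k.+2) : codegen i j = unbump i j :> nat.
Proof.
rewrite /codegen inordK// /unbump; case: (ltnP i j) => ij /=.
  have j0 : (0 < j)%N by exact: leq_ltn_trans ij.
  by rewrite subn1 prednK// -ltnS.
by rewrite subn0; exact: leq_ltn_trans ij _.
Qed.

Lemma codegen_homo k (i : 'I_k.+1) : {homo codegen i : j l / (j <= l)%N}.
Proof.
move=> j l jl; rewrite !codegenE /unbump; case: (ltnP i j) => ij.
  by rewrite (leq_trans ij jl) leq_sub2r.
case: ltnP => il; last by rewrite /= !subn0.
by rewrite /= subn0 subn1 (leq_trans ij)// -ltnS (ltn_predK il).
Qed.

Lemma nerve_map_subproof m k (f : 'I_m.+1 -> 'I_k.+1)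
    (hf : {homo f : i j / (i <= j)%N}) (x : nerve k) :
  (fun i => val x (f i)) \in nerve_set m.
Proof.
by rewrite inE => i j ij; have := set_mem (valP x); apply; exact: hf.
Qed.

Definition nerve_map m k (f : 'I_m.+1 -> 'I_k.+1)
    (hf : {homo f : i j / (i <= j)%N}) (x : nerve k) : nerve m :=
  SigSub (nerve_map_subproof hf x).

Lemma simplex_map_subproof m k (f : 'I_m.+1 -> 'I_k.+1) (t : simplex m) :
  (fun j => \sum_(i | f i == j) val t i) \in simplex_set k.
Proof.
have [t0 t1] := set_mem (valP t).
rewrite inE; split=> [j|]; first by apply: sumr_ge0 => i _; exact: t0.
by apply: (etrans _ t1); rewrite [RHS](partition_big f xpredT).
Qed.

Definition simplex_map m k (f : 'I_m.+1 -> 'I_k.+1) (t : simplex m) :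
  simplex k := SigSub (simplex_map_subproof f t).

Definition realization_sum := {k : nat & (nerve k * simplex k)%type}.
HB.instance Definition _ := Topological.on realization_sum.

Definition realization_point k (x : nerve k) (t : simplex k) : realization_sum :=
  existT (fun k => (nerve k * simplex k)%type) k (x, t).

Inductive realization_step : relation realization_sum :=
| face_step k (i : 'I_k.+2) (x : nerve k.+1) (t : simplex k) :
    realization_step
      (realization_point (nerve_map (lift_homo i) x) t)
      (realization_point x (simplex_map (lift i) t))
| degen_step k (i : 'I_k.+1) (x : nerve k) (t : simplex k.+1) :
    realization_step
      (realization_point (nerve_map (codegen_homo i) x) t)
      (realization_point x (simplex_map (codegen i) t)).

Definition realization_rel (p q : realization_sum) : bool :=
  `[< clos_refl_sym_trans _ realization_step p q >].

Lemma realization_rel_refl : reflexive realization_rel.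
Proof. by move=> p; apply/asboolP; exact: rst_refl. Qed.

Lemma realization_rel_sym : symmetric realization_rel.
Proof. by move=> p q; apply/asboolP/asboolP; exact: rst_sym. Qed.

Lemma realization_rel_trans : transitive realization_rel.
Proof.
by move=> q p r /asboolP pq /asboolP qr; apply/asboolP; exact: rst_trans pq qr.
Qed.

Definition realization_equiv := EquivRel realization_rel
  realization_rel_refl realization_rel_sym realization_rel_trans.

Definition order_complex : Type := {eq_quot realization_equiv}.
HB.instance Definition _ := Quotient.on order_complex.
HB.instance Definition _ :=
  Topological.copy order_complex (quotient_topology order_complex).

End simplicial_maps.

(* ['rV[R]_m] carries the sup norm, hence the explicit Euclidean ball. *)
Definition unit_ball (R : realType) (m : nat) : set 'rV[R]_m :=
  [set x | \sum_i x ord0 i ^+ 2 <= 1].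
Arguments unit_ball : clear implicits.

Definition homeomorphic (X Y : topologicalType) : Prop :=
  exists (f : X -> Y) (g : Y -> X),
    [/\ continuous f, continuous g, cancel f g & cancel g f].

Definition ones_perp_last1 (R : realType) (n : nat) :
    set {ptws 'I_n -> phase R} :=
  [set x | ones_perp R n x /\ forall i : 'I_n, i.+1 = n -> x i = phase1 R].
Arguments ones_perp_last1 : clear implicits.

Definition homeomorphic_ball (R : realType) (m : nat) (X : topologicalType) : Prop :=
  homeomorphic X (unit_ball R m).
Arguments homeomorphic_ball : clear implicits.

(* Main.v *)
(* A point of the realization is a chain x_0 <= ... <= x_k with weights t_j; its
   barycenter z = sum_j t_j x_j lies in a product of unit discs, and thresholding
   the moduli |z_i| recovers the chain.  Since the minimal element of the chain
   determines which |z_i| equal 1, the realization is identified with the set of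
   all z in the product of discs with z_n = 1 and 0 in the convex hull of
   {z_i : |z_i| = 1}.  By the Karush-Kuhn-Tucker conditions this says that,
   among all translates (z_i + c)_{i < n} staying in the discs, c = 0 has minimal
   real part.  Strict convexity of the disc makes the minimizer unique, so the
   differences z_i - z_1 embed this set onto {y : some translate of (0, y) lies
   in the product of discs}, a convex body in C^(n-2); a convex body is a ball by
   radial rescaling with its Minkowski functional. *)
Require Import Defs.
Set Warnings "-notation-overridden,-ambiguous-paths,-notation-incompatible-prefix".
From Stdlib Require Import Relations.
From mathcomp Require Import all_boot all_order all_algebra complex.
From mathcomp Require Import all_classical all_reals topology normedtype trigo.
From mathcomp Require Import derive realfun ring lra.
Set Implicit Arguments.
Unset Strict Implicit.
Unset Printing Implicit Defensive.
Import Order.TTheory GRing.Theory Num.Theory.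
Import numFieldNormedType.Exports.
Local Open Scope classical_set_scope.
Local Open Scope ring_scope.
Local Open Scope complex_scope.
Local Open Scope quotient_scope.
(* [Num.Theory] exports its own [Re] and [Im], valued in [R[i]]. *)
Local Notation Re := (@complex.Re _).
Local Notation Im := (@complex.Im _).

(** * Topology and convex bodies *)

Section topology_facts.

(** The quotient topology of the realization is awkward: separation, or continuity of a map back
    into it, is hard to check by hand. Both are avoided. By [barycenter_surj] chains of one fixed
    length reach every point, so the realization is a continuous image of the compact space
    [nerve T k * simplex R k] for a single [k], and a continuous bijection from it onto a Hausdorff
    space is a homeomorphism. The convex body inherits its compactness as an image.

    Hyperaddition is given by shortest arcs and has to be made linear: 0 lies in the hypersum iff
    some nontrivial nonnegative combination of the nonzero entries vanishes, or all entries are 0.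
    Induction on the summands requires describing every member [w] of the hypersum, not only 0.

    Gordan's alternative then trades the weights for half-planes: every closed half-plane
    [0 <= dot u _] contains a suitable point. This form is visibly closed, passes from chains to
    barycenters without a choice of weights, and, tested on well-chosen directions [u], yields
    rigidity of translations. *)

Lemma compact_bij_homeomorphic (X Y : topologicalType) (f : X -> Y) :
  compact [set: X] -> hausdorff_space Y -> continuous f -> injective f ->
  (forall y, exists x, f x = y) -> homeomorphic X Y.
Proof.
move=> cX hY cf injf surjf.
have [g fg] := choice surjf.
have gf : cancel f g by move=> x; apply: injf; rewrite fg.
exists f, g; split=> //.
apply/continuous_closedP => A cA.
have -> : g @^-1` A = f @` A.
  apply/seteqP; split => [y /= Agy|_ [x Ax <-] /=]; last by rewrite gf.
  by exists (g y).
apply: compact_closed => //; apply: continuous_compact.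
  exact: continuous_subspaceT.
exact: subclosed_compact cA cX _.
Qed.

Lemma compact_set_type (T : topologicalType) (A : set T) :
  compact A -> compact [set: set_type A].
Proof.
move=> cA F FF _.
have FFA : ProperFilter (fmap (val : A -> T) F) by exact: fmap_proper_filter.
have [|x [Ax clx]] := cA _ FFA.
  by apply: (@filterS _ F _ setT) => [[x xA] _|]; [exact: set_mem|exact: filterT].
exists (SigSub (mem_set Ax)); split => // B C FB [D [[E oE <-] /= Ex EC]].
have FB' : fmap (val : A -> T) F (val @` B).
  by apply: (@filterS _ F _ B) FB => z Bz; exists z.
have Ex' : nbhs x E by exact: open_nbhs_nbhs.
have [y [[z Bz <-] Ez]] := clx _ _ FB' Ex'.
by exists z; split => //; exact: EC.
Qed.

Lemma set_type_continuous (S T : topologicalType) (A : set T) (f : S -> A) :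
  continuous (fun x => val (f x) : T) -> continuous f.
Proof. by move=> cf; apply: (@continuous_comp_initial _ _ _ (val : A -> T)). Qed.

Lemma homeomorphic_trans (X Y Z : topologicalType) :
  homeomorphic X Y -> homeomorphic Y Z -> homeomorphic X Z.
Proof.
move=> [f [g [cf cg fg gf]]] [h [k [ch ck hk kh]]].
exists (h \o f), (g \o k); split.
- by move=> x; apply: continuous_comp; [exact: cf|exact: ch].
- by move=> x; apply: continuous_comp; [exact: ck|exact: cg].
- by move=> x /=; rewrite hk fg.
- by move=> x /=; rewrite gf kh.
Qed.

Lemma set_type_hausdorff_space (T : topologicalType) (A : set T) :
  hausdorff_space T -> hausdorff_space (set_type A).
Proof.
move=> hT x y xy; apply: val_inj; apply: hT => U V Ux Vy.
have [z [Uz Vz]] : (val @^-1` U : set A) `&` (val @^-1` V) !=set0.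
  by apply: xy; exact: (@initial_continuous A T val).
by exists (val z).
Qed.

Lemma sum_continuous (R : realType) (X : topologicalType) (I : Type) (s : seq I)
    (P : pred I) (f : I -> X -> R) (x : X) :
  (forall i, {for x, continuous (f i)}) ->
  {for x, continuous (fun x => \sum_(i <- s | P i) f i x)}.
Proof.
move=> cf; elim: s => [|i s IH].
  rewrite (_ : (fun _ => _) = fun=> 0); first exact: cst_continuous.
  by apply/funext => y; rewrite big_nil.
rewrite (_ : (fun _ => _) = fun y => if P i then f i y + \sum_(j <- s | P j) f j y
   else \sum_(j <- s | P j) f j y); last first.
  by apply/funext => y; rewrite big_cons.
by case: (P i) => //; apply: cvgD; [exact: cf|exact: IH].
Qed.

End topology_facts.

(** * Radial rescaling between sublevel sets of gauges *)

Section radial.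
Context (R : realType) (V : normedModType R).

(** [gauge_norm] carries two facts: positivity away from 0, and the bound that makes [radial]
    continuous at 0. *)
Record gauge_spec (p : V -> R) : Prop := {
  gauge_ge0 : forall x, 0 <= p x ;
  gauge_cont : continuous p ;
  gaugeZ : forall (t : R) x, 0 <= t -> p (t *: x) = t * p x ;
  gauge_norm : exists2 c, 0 < c & forall x, `|x| <= c * p x }.

Lemma gauge0 p : gauge_spec p -> p 0 = 0.
Proof. by move=> hp; rewrite -(scale0r 0) (gaugeZ hp) ?lexx// mul0r. Qed.

Lemma gauge_gt0 p x : gauge_spec p -> x != 0 -> 0 < p x.
Proof.
move=> hp x0; have [c c0 /(_ x)] := gauge_norm hp.
by rewrite -(pmulr_rgt0 _ c0); apply: lt_le_trans; rewrite normr_gt0.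
Qed.

Definition radial (p q : V -> R) (x : V) : V := (p x / q x) *: x.

Lemma gauge_radial p q x : gauge_spec p -> gauge_spec q -> q (radial p q x) = p x.
Proof.
move=> hp hq; rewrite /radial (gaugeZ hq); last first.
  by rewrite divr_ge0// gauge_ge0.
have [->|x0] := eqVneq x 0; first by rewrite !gauge0// mulr0.
by rewrite divfK// gt_eqF// gauge_gt0.
Qed.

Lemma radialK p q : gauge_spec p -> gauge_spec q ->
  cancel (radial p q) (radial q p).
Proof.
move=> hp hq x; rewrite {1}/radial gauge_radial//.
have [->|x0] := eqVneq x 0; first by rewrite /radial !scaler0.
rewrite /radial scalerA (gaugeZ hp); last by rewrite divr_ge0// gauge_ge0.
have p0 : p x != 0 by rewrite gt_eqF// gauge_gt0.
have q0 : q x != 0 by rewrite gt_eqF// gauge_gt0.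
by rewrite [X in X *: _](_ : _ = 1) ?scale1r//; field; rewrite p0 q0.
Qed.

(** The factor [p x / q x] need not have a limit at 0. There the norm of [radial p q x] is at most a
    constant times its [q]-value, which is [p x] and tends to 0. *)
Lemma radial_continuous p q : gauge_spec p -> gauge_spec q ->
  continuous (radial p q).
Proof.
move=> hp hq x; have [->|x0] := eqVneq x 0.
  have [c c0 nq] := gauge_norm hq.
  rewrite /continuous_at; have -> : radial p q 0 = 0 by rewrite /radial scaler0.
  apply/cvgr0Pnorm_le => e e0 /=.
  have : \forall y \near (0 : V), p y < e / c.
    have := @gauge_cont _ hp 0; rewrite /continuous_at gauge0// => /cvgrPdist_lt/(_ (e / c)).
    rewrite divr_gt0// => /(_ isT); apply: filterS => y.
    by rewrite sub0r normrN ger0_norm ?gauge_ge0.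
  apply: filterS => y pye; rewrite (le_trans (nq _))// gauge_radial//.
  by rewrite mulrC -ler_pdivlMr// ltW.
apply: cvgZ; last exact: cvg_id.
apply: cvgM; first exact: gauge_cont.
by apply: cvgV; [rewrite gt_eqF// gauge_gt0|exact: gauge_cont].
Qed.

Lemma radial_homeomorphic p q : gauge_spec p -> gauge_spec q ->
  homeomorphic [set x | p x <= 1] [set x | q x <= 1].
Proof.
move=> hp hq.
have h (p' q' : V -> R) (hp' : gauge_spec p') (hq' : gauge_spec q')
    (x : [set x | p' x <= 1]) : radial p' q' (val x) \in [set x | q' x <= 1].
  by rewrite inE/= gauge_radial//; exact: set_mem (valP x).
pose f (p' q' : V -> R) (hp' : gauge_spec p') (hq' : gauge_spec q') x :
  [set x | q' x <= 1] := SigSub (h p' q' hp' hq' x).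
have cf p' q' hp' hq' : continuous (f p' q' hp' hq').
  apply: set_type_continuous => /= x.
  apply: (@continuous_comp _ _ _ (val : [set x | p' x <= 1] -> V) (radial p' q')).
    exact: initial_continuous.
  exact: radial_continuous.
exists (f p q hp hq), (f q p hq hp); split; [exact: cf|exact: cf| |].
  by move=> x; apply: val_inj; exact: radialK.
by move=> x; apply: val_inj; exact: radialK.
Qed.

End radial.

(** * The Minkowski functional of a compact convex neighbourhood of 0 *)

Section minkowski.
Context (R : realType) (V : normedModType R) (K : set V).
Context (cK : compact K) (K0 : nbhs 0 K).
Context (convK : forall x y (t : R), 0 <= t <= 1 -> K x -> K y ->
  K (t *: x + (1 - t) *: y)).

(** The condition [0 < r] matters: since [0^-1 = 0] and [K] contains 0, the value [r = 0] would
    otherwise belong to every [S x]. *)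
Let S (x : V) : set R := [set r | 0 < r /\ K (r^-1 *: x)].

Definition minkowski (x : V) : R := inf (S x).
Local Notation p := minkowski.

Let K00 : K 0. Proof. exact: nbhs_singleton. Qed.

Let K_scale (t : R) x : 0 <= t <= 1 -> K x -> K (t *: x).
Proof. by move=> t01 Kx; rewrite -[_ *: _]addr0 -(scaler0 _ (1 - t)); exact: convK. Qed.

Let lbS x : has_lbound (S x).
Proof. by exists 0 => r [/ltW]. Qed.

Let exC : exists2 C, 0 < C & forall x r, C * `|x| < r -> S x r.
Proof.
have /nbhs_normP [e /= e0 eK] := K0.
exists e^-1; first by rewrite invr_gt0.
move=> x r xr.
have r0 : 0 < r by apply: le_lt_trans xr; rewrite mulr_ge0// invr_ge0 ltW.
split=> //; apply: eK; rewrite /= sub0r normrN normrZ gtr0_norm ?invr_gt0//.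
by rewrite ltr_pdivrMl// mulrC -ltr_pdivrMl.
Qed.

Let S0 x : S x !=set0.
Proof.
have [C _ CS] := exC; exists (C * `|x| + 1); apply: CS.
by rewrite ltrDl.
Qed.

Let S_up x r s : S x r -> r <= s -> S x s.
Proof.
move=> [r0 Kr] rs; have s0 := lt_le_trans r0 rs; split => //.
have -> : s^-1 *: x = (r / s) *: (r^-1 *: x).
  by rewrite scalerA mulrAC mulfV ?mul1r// gt_eqF.
by apply: K_scale => //; rewrite divr_ge0 ?(ltW r0) ?(ltW s0)//= ler_pdivrMr// mul1r.
Qed.

Let S_gt x r : p x < r -> S x r.
Proof. by move=> /(inf_lt (S0 x))[s Ss /ltW]; exact: S_up. Qed.

Let p_le x r : S x r -> p x <= r.
Proof. exact: ge_inf. Qed.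

Let p_ge0 x : 0 <= p x.
Proof. by apply: lb_le_inf => // r [/ltW]. Qed.

Let p_bound : exists2 C, 0 < C & forall x, p x <= C * `|x|.
Proof.
have [C C0 CS] := exC; exists C => // x.
by apply/ler_addgt0Pr => e e0; apply/p_le/CS; rewrite ltrDl.
Qed.

(** The point [(x + y) / (r + s)] is the convex combination of [x / r] and [y / s] with weights
    [r / (r + s)] and [s / (r + s)]. *)
Let p_subadd x y : p (x + y) <= p x + p y.
Proof.
apply/ler_addgt0Pr => e e0; have e20 : 0 < e / 2 by rewrite divr_gt0.
have [r0 Kr] : S x (p x + e / 2) by apply: S_gt; rewrite ltrDl.
have [s0 Ks] : S y (p y + e / 2) by apply: S_gt; rewrite ltrDl.
set r := p x + _ in r0 Kr; set s := p y + _ in s0 Ks.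
have -> : p x + p y + e = r + s by rewrite /r /s; field.
have rs0 : 0 < r + s by rewrite addr_gt0.
apply: p_le; split => //.
have -> : (r + s)^-1 *: (x + y) =
   (r / (r + s)) *: (r^-1 *: x) + (1 - r / (r + s)) *: (s^-1 *: y).
  rewrite !scalerA scalerDr; congr (_ *: _ + _ *: _); field.
    by rewrite !gt_eqF.
  by rewrite !gt_eqF.
apply: convK => //.
by rewrite divr_ge0 ?(ltW r0) ?(ltW rs0)//= ler_pdivrMr// mul1r lerDl ltW.
Qed.

Let pZ_le (t : R) x : 0 < t -> p (t *: x) <= t * p x.
Proof.
move=> t0; apply/ler_addgt0Pr => e e0.
have [r0 Kr] : S x (p x + e / t) by apply: S_gt; rewrite ltrDl divr_gt0.
have -> : t * p x + e = t * (p x + e / t) by field; rewrite gt_eqF.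
apply: p_le; split; first by rewrite mulr_gt0.
by rewrite scalerA invfM mulrAC mulVf ?mul1r// gt_eqF.
Qed.

Let p0 : p 0 = 0.
Proof.
by have [C _ /(_ 0)] := p_bound; rewrite normr0 mulr0 => h; apply/le_anti/andP.
Qed.

Let pZ (t : R) x : 0 <= t -> p (t *: x) = t * p x.
Proof.
rewrite le_eqVlt => /predU1P[<-|t0]; first by rewrite scale0r mul0r p0.
apply/eqP; rewrite eq_le pZ_le//= -ler_pdivlMl//.
have := @pZ_le t^-1 (t *: x); rewrite invr_gt0 => /(_ t0).
by rewrite scalerA mulVf ?gt_eqF// scale1r.
Qed.

Lemma minkowski_gauge : gauge_spec minkowski.
Proof.
split; [exact: p_ge0| |exact: pZ|].
- move=> x; apply/cvgrPdist_le => e e0.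
  have [C C0 pC] := p_bound.
  near=> y.
  have yx : `|x - y| <= e / C.
    by near: y; apply: cvgr_dist_le; [exact: cvg_id|rewrite divr_gt0].
  have pe z : `|z| <= e / C -> p z <= e.
    by rewrite ler_pdivlMr// mulrC => /(le_trans (pC z)).
  rewrite ler_distl; apply/andP; split.
    rewrite lerBlDr; have := p_subadd x (y - x); rewrite subrKC => /le_trans; apply.
    by rewrite lerD2l pe// distrC.
  have := p_subadd (x - y) y; rewrite subrK addrC => /le_trans; apply.
  by rewrite lerD2l pe.
- have [M [Mr MK]] := compact_bounded cK.
  have M1 : 0 < `|M| + 1 by rewrite ltr_wpDl.
  (* [MK] applies only to bounds strictly above [M], whose sign is unknown; [|M| + 1] is above [M]
     and positive. *)
  exists (`|M| + 1) => // x; apply/ler_addgt0Pr => e e0.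
  have [r0 Kr] : S x (p x + e / (`|M| + 1)) by apply: S_gt; rewrite ltrDl divr_gt0.
  have := MK (`|M| + 1) _ _ Kr; rewrite /= normrZ gtr0_norm ?invr_gt0//.
  rewrite ler_pdivrMl// => /(_ _)/le_trans; apply.
    by rewrite (le_lt_trans (ler_norm M))// ltrDl.
  by rewrite mulrDl mulrC divfK ?gt_eqF.
Unshelve. all: by end_near. Qed.

(** If [p x <= 1], convexity only gives [r *: x] in [K] for [0 < r < 1]; closedness of [K] supplies
    the limit [r = 1]. *)
Lemma minkowski_le1 : [set x | p x <= 1] = K.
Proof.
apply/seteqP; split => x /=; last first.
  by move=> Kx; apply: p_le; split => //; rewrite invr1 scale1r.
move=> px; have clK := compact_closed (@norm_hausdorff _ V) cK.
have cv : (r *: x) @[r --> (1:R)^'-] --> x.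
  rewrite -[X in _ --> X]scale1r; apply: cvgZr_tmp.
  exact: (@cvg_at_left_filter _ _ id).
apply: (@closed_cvg _ _ ((1 : R)^'-) _ (fun r : R => r *: x) K clK _ x cv).
near=> r.
have r0 : 0 < r by near: r; exact: nbhs_left_gt.
have r1 : r < 1 by near: r; exact: nbhs_left_lt.
have : p x < r^-1 by apply: (le_lt_trans px); rewrite invf_gt1.
by move=> /S_gt[_]; rewrite invrK.
Unshelve. all: by end_near. Qed.

End minkowski.

Section convex_body.
Context (R : realType) (d : nat).
Implicit Types x : 'rV[R]_d.

Definition eucl x : R := Num.sqrt (\sum_i x ord0 i ^+ 2).

Lemma eucl_sum_ge0 x : 0 <= \sum_i x ord0 i ^+ 2.
Proof. by apply: sumr_ge0 => i _; exact: sqr_ge0. Qed.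

Lemma eucl_gauge : gauge_spec eucl.
Proof.
split.
- by move=> x; exact: sqrtr_ge0.
- move=> x; apply: (continuous_comp (f := fun x => \sum_i x ord0 i ^+ 2)).
    apply: sum_continuous => i.
    have cx' := @coord_continuous R 1 d ord0 i x.
    exact: (cvgM cx' cx').
  exact: sqrt_continuous.
- move=> t x t0; rewrite /eucl.
  under eq_bigr do rewrite mxE exprMn.
  by rewrite -mulr_sumr sqrtrM ?sqr_ge0// sqrtr_sqr ger0_norm.
- exists 1 => // x; rewrite mul1r.
  change (mx_norm x <= eucl x); rewrite mx_normrE; apply/bigmax_leP; split; first exact: sqrtr_ge0.
  move=> -[i j] _ /=; rewrite ord1 -sqrtr_sqr ler_sqrt ?eucl_sum_ge0//.
  by rewrite (bigD1 j)//= lerDl; apply: sumr_ge0 => k _; exact: sqr_ge0.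
Qed.

Lemma convex_body_ball (K : set 'rV[R]_d) : compact K -> nbhs (0 : 'rV[R]_d) K ->
  (forall x y (t : R), 0 <= t <= 1 -> K x -> K y -> K (t *: x + (1 - t) *: y)) ->
  homeomorphic K (unit_ball R d).
Proof.
move=> cK K0 convK.
have := radial_homeomorphic (minkowski_gauge cK K0 convK) eucl_gauge.
rewrite minkowski_le1//; congr homeomorphic; congr set_type.
have E x : (eucl x <= 1) = (\sum_i x ord0 i ^+ 2 <= 1).
  by rewrite /eucl -[X in _ <= X]sqrtr1 ler_sqrt// ltr01.
by apply/seteqP; split=> x /=; rewrite E.
Qed.

End convex_body.

(** * The plane and its arcs *)

Section plane.
Context (R : realType).
Implicit Types (z w v y : R[i]) (a b s t : R).

Lemma ReD z w : Re (z + w) = Re z + Re w. Proof. by case: z w => [? ?] []. Qed.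
Lemma ImD z w : Im (z + w) = Im z + Im w. Proof. by case: z w => [? ?] []. Qed.
Lemma ReN z : Re (- z) = - Re z. Proof. by case: z. Qed.
Lemma ImN z : Im (- z) = - Im z. Proof. by case: z. Qed.
Lemma ReZ a z : Re (a%:C * z) = a * Re z.
Proof. by case: z => x y /=; rewrite mul0r subr0. Qed.
Lemma ImZ a z : Im (a%:C * z) = a * Im z.
Proof. by case: z => x y /=; rewrite mul0r addr0. Qed.

Lemma complex_ext z w : Re z = Re w -> Im z = Im w -> z = w.
Proof. by case: z w => [? ?] [? ?] /= -> ->. Qed.

Lemma Re_sum (I : Type) (r : seq I) (P : pred I) (F : I -> R[i]) :
  Re (\sum_(i <- r | P i) F i) = \sum_(i <- r | P i) Re (F i).
Proof. by apply: big_morph => // z w; exact: ReD. Qed.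

Lemma Im_sum (I : Type) (r : seq I) (P : pred I) (F : I -> R[i]) :
  Im (\sum_(i <- r | P i) F i) = \sum_(i <- r | P i) Im (F i).
Proof. by apply: big_morph => // z w; exact: ImD. Qed.

Definition sqn z : R := Re z ^+ 2 + Im z ^+ 2.

Lemma norm1_sqn z : `|z| = 1 -> sqn z = 1.
Proof.
rewrite normc_def => /(congr1 (@complex.Re R))/= => h.
have : Num.sqrt (sqn z) ^+ 2 = 1 by rewrite h expr1n.
by rewrite sqr_sqrtr// addr_ge0 ?sqr_ge0.
Qed.

Lemma sqn_norm1 z : sqn z = 1 -> `|z| = 1.
Proof. by move=> h; rewrite normc_def -/(sqn z) h sqrtr1. Qed.

Lemma sqn_ge0 z : 0 <= sqn z.
Proof. by rewrite addr_ge0 ?sqr_ge0. Qed.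

Lemma sqn_eq0 z : sqn z = 0 -> z = 0.
Proof.
move=> /eqP; rewrite paddr_eq0 ?sqr_ge0// !sqrf_eq0 => /andP[/eqP ? /eqP ?].
exact: complex_ext.
Qed.

Lemma sqnZ a z : sqn (a%:C * z) = a ^+ 2 * sqn z.
Proof. by rewrite /sqn ReZ ImZ; ring. Qed.

Lemma sqnN z : sqn (- z) = sqn z.
Proof. by rewrite /sqn ReN ImN !sqrrN. Qed.

Lemma sqn1_neq0 z : sqn z = 1 -> z != 0.
Proof. by apply: contra_eq_neq => ->; rewrite /sqn/= expr0n/= addr0 eq_sym oner_eq0. Qed.

Lemma unit_scale_inj a b z w : sqn z = 1 -> sqn w = 1 -> 0 < a -> 0 <= b ->
  a%:C * z = b%:C * w -> z = w.
Proof.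
move=> z1 w1 a0 b0 e; have := congr1 sqn e; rewrite !sqnZ z1 w1 !mulr1.
move=> /eqP; rewrite eqrXn2 ?(ltW a0)// => /eqP ab; move: e; rewrite -ab.
by apply: mulfI; rewrite eq_complex/= negb_and gt_eqF.
Qed.

Lemma sqn_cis t : sqn (cis t) = 1.
Proof. exact: cos2Dsin2. Qed.

Lemma cisD s t : cis (s + t) = cis s * cis t.
Proof.
by apply: complex_ext => /=; rewrite ?cosD ?sinD//; ring.
Qed.

Lemma polar z : sqn z = 1 -> exists2 t, - pi < t <= pi & z = cis t.
Proof.
move=> z1; have Re1 : -1 <= Re z <= 1.
  have : Re z ^+ 2 <= 1 by rewrite -z1 lerDl sqr_ge0.
  by move=> ?; apply/andP; split; nra.
have [Im0|Im0] := leP 0 (Im z).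
  exists (acos (Re z)).
    rewrite acos_lepi// andbT (lt_le_trans _ (acos_ge0 _))// oppr_lt0.
    exact: pi_gt0.
  apply: complex_ext => /=; first by rewrite acosK.
  rewrite sin_acos// -z1 /sqn addrC addKr sqrtr_sqr ger0_norm//.
exists (- acos (Re z)).
  rewrite ltrNl opprK (le_trans (y := 0)) ?pi_ge0 ?oppr_le0 ?acos_ge0//.
  rewrite andbT lt_neqAle acos_lepi// andbT; apply: contraTneq Im0 => e.
  have Rez : Re z = -1 by rewrite -(acosK _ : cos (acos (Re z)) = _)// e cospi.
  have : Im z ^+ 2 = 0 by move: z1; rewrite /sqn Rez sqrrN expr1n; lra.
  by move=> /eqP; rewrite sqrf_eq0 => /eqP ->; rewrite ltxx.
apply: complex_ext => /=; first by rewrite cosN acosK.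
rewrite sinN sin_acos// -z1 /sqn addrC addKr sqrtr_sqr ltr0_norm// opprK//.
Qed.

Lemma polar_from a z : sqn z = 1 ->
  exists2 t, - pi < t <= pi & z = cis (a + t).
Proof.
move=> z1; have [t tpi e] : exists2 t, - pi < t <= pi & z * cis (- a) = cis t.
  apply: polar; move: z1; rewrite /sqn.
  case: z => x y /=; rewrite cosN sinN => z1.
  transitivity ((x ^+ 2 + y ^+ 2) * (cos a ^+ 2 + sin a ^+ 2)); first by ring.
  by rewrite z1 cos2Dsin2 mulr1.
exists t => //; rewrite cisD -e mulrCA -cisD addrN.
by rewrite /cis cos0 sin0 mulr1.
Qed.

Lemma cos_dist a b : cos (b - a) = Re (cis a) * Re (cis b) + Im (cis a) * Im (cis b).
Proof. by rewrite cosB /=; ring. Qed.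

Lemma sin_eq0_itv t : 0 <= t < pi -> sin t = 0 -> t = 0 :> R.
Proof.
move=> /andP[t0 tpi] st; apply/eqP; rewrite eq_le t0 andbT leNgt.
by apply/negP => t1; have := sin_gt0_pi (_ : 0 < t < pi); rewrite t1 tpi st ltxx => /(_ isT).
Qed.

Lemma cisDpi t : cis (t + pi) = - cis t.
Proof. by apply: complex_ext; rewrite ?ReN ?ImN/= ?cosDpi ?sinDpi. Qed.

Lemma cisD2pi t : cis (t + pi *+ 2) = cis t.
Proof. by rewrite mulr2n addrA !cisDpi opprK. Qed.

Lemma cis_combination a b t : (sin (b - a))%:C * cis t =
  (sin (b - t))%:C * cis a + (sin (t - a))%:C * cis b.
Proof.
by apply: complex_ext; rewrite ?ReD ?ImD !(ReZ, ImZ) /= !sinB; ring.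
Qed.

(** Conical form of membership in the shortest arc. For unit [v] and [y], the value [c = 0] is
    possible only when [y = - v], which is exactly the case where the hypersum is everything. *)
Definition arc_weights v y w := exists a b c,
  [/\ 0 <= a, 0 <= b, 0 <= c, 0 < a + b & a%:C * v + b%:C * y = c%:C * w].

Lemma arc_weightsC v y w : arc_weights v y w -> arc_weights y v w.
Proof.
by move=> [a [b [c [a0 b0 c0 ab e]]]]; exists b, a, c; split; rewrite // addrC.
Qed.

(** The weights are the sines in [cis_combination]; they are nonnegative because all angles involved
    lie in [[0, pi)]. *)
Lemma arc_weights_sub a b t : a <= t <= b -> b - a < pi ->
  arc_weights (cis a) (cis b) (cis t).
Proof.
move=> /andP[at_ tb] bapi.
have sin_ge0 x : 0 <= x <= b - a -> 0 <= sin x.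
  move=> /andP[x0 xba]; apply: sin_ge0_pi; rewrite x0/=; lra.
(* For a one-point arc all three sines vanish, so weights are chosen by hand. *)
have [ab|ab] := eqVneq a b.
  have -> : t = a by lra.
  by exists 1, 0, 1; rewrite mul0r addr0 ler01 lexx addr0 ltr01.
exists (sin (b - t)), (sin (t - a)), (sin (b - a)); split.
- by apply: sin_ge0; lra.
- by apply: sin_ge0; lra.
- by apply: sin_ge0; lra.
- rewrite lt_neqAle addr_ge0 ?andbT; [|by apply: sin_ge0; lra..].
  rewrite eq_sym paddr_eq0; [|by apply: sin_ge0; lra..].
  apply: contra ab => /andP[/eqP s1 /eqP s2].
  have : b - t = 0 by apply: sin_eq0_itv s1; lra.
  have : t - a = 0 by apply: sin_eq0_itv s2; lra.
  by move=> ? ?; apply/eqP; lra.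
- exact/esym/cis_combination.
Qed.

(** After rotation by [- a], write [w] as [cis s] with [s] in [(- pi, pi]]. Comparing imaginary
    parts, and then eliminating, shows that [sin s] and [sin (d - s)] are nonnegative, which
    confines [s] to [[0, d]]. *)
Lemma weights_arc a d w : 0 <= d < pi -> sqn w = 1 ->
  arc_weights (cis a) (cis (a + d)) w -> closed_arc a (a + d) w.
Proof.
move=> /andP[d0 dpi] w1 [p [q [r [p0 q0 r0 pq e]]]].
have [s /andP[s1 s2] ws] := polar_from a w1.
have ecis : p%:C + q%:C * cis d = r%:C * cis s.
  have ca : cis a != 0 := sqn1_neq0 (sqn_cis a).
  apply: (mulfI ca); rewrite mulrDr [cis a * p%:C]mulrC mulrCA [RHS]mulrCA.
  by rewrite -!cisD -ws.
have eRe : p + q * cos d = r * cos s.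
  by have := congr1 (@complex.Re R) ecis; rewrite ReD !ReZ /=.
have eIm : q * sin d = r * sin s.
  by have := congr1 (@complex.Im R) ecis; rewrite ImD !ImZ /= add0r.
have r_gt0 : 0 < r.
  rewrite lt_neqAle r0 andbT; apply/negP => /eqP r00.
  have [q00|q00] := eqVneq q 0; first by move: eRe pq; rewrite q00 -r00; lra.
  have sd : sin d = 0.
    by apply/eqP; have := eIm; rewrite -r00 mul0r => /eqP; rewrite mulf_eq0 (negbTE q00).
  have dd : d = 0 by apply: sin_eq0_itv => //; rewrite d0.
  by move: eRe; rewrite dd cos0 -r00; lra.
have sd0 : 0 <= sin d by apply: sin_ge0_pi; rewrite d0 ltW.
have s0 : 0 <= s.
  rewrite leNgt; apply/negP => sn.
  have : 0 < sin (- s) by apply: sin_gt0_pi; lra.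
  rewrite sinN; have : 0 <= r * sin s by rewrite -eIm mulr_ge0.
  by rewrite pmulr_rge0//; lra.
have sds : 0 <= sin (d - s).
  rewrite -(pmulr_rge0 _ r_gt0) sinB.
  have -> : r * (sin d * cos s - cos d * sin s) = p * sin d.
    transitivity (sin d * (r * cos s) - cos d * (r * sin s)); first by ring.
    by rewrite -eRe -eIm; ring.
  exact: mulr_ge0.
exists (a + s) => //=; rewrite lerDl s0 /= lerD2l leNgt; apply/negP => ds.
(* The only way for [sin (s - d)] to vanish with [d < s] is [d = 0] and [s = pi], where the real
   parts read [p + q = - r], against the signs. *)
have [sdpi|sdpi] := eqVneq (s - d) pi.
  have dd : d = 0 by lra.
  have ss : s = pi by lra.
  by move: eRe; rewrite dd ss cos0 cospi; lra.
have : 0 < sin (s - d).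
  apply: sin_gt0_pi; rewrite subr_gt0 ds/= lt_neqAle sdpi/=; lra.
by rewrite -opprB sinN; lra.
Qed.

(** The inner product of the endpoints is the cosine of the length of any arc joining them, and
    cosine is strictly decreasing on [[0, pi]]. *)
Lemma smallest_arc_from a d : 0 <= d < pi ->
  forall a' b', arc_joins a' b' (cis a) (cis (a + d)) -> d <= b' - a'.
Proof.
move=> /andP[d0 dpi] a' b' [ab' jn].
have cosE : cos (b' - a') = cos d.
  have -> : d = (a + d) - a by rewrite addrC addKr.
  by rewrite !cos_dist; case: jn => -[-> ->]//; ring.
rewrite leNgt; apply/negP => bd.
have := @ltr_cos R (b' - a') d; rewrite cosE ltxx bd !in_itv/=.
by rewrite d0 subr_ge0 ab' !ltW ?(lt_trans bd)// => /(_ isT isT).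
Qed.

Lemma smallest_arcP v y w : sqn v = 1 -> sqn y = 1 -> sqn w = 1 -> y != - v ->
  smallest_arc v y w <-> arc_weights v y w.
Proof.
move=> v1 y1 w1 yv; split.
  move=> [a [b [[ab jn] small [t /= tab <-]]]].
  (* Two competitors bound the length of a smallest arc: the arc shortened by a full turn when it
     exceeds [2 pi], and otherwise the complementary arc from [b] to [a + 2 pi]. *)
  have bapi : b - a <= pi.
    have [b2|b2] := leP (b - a) (pi *+ 2); last first.
      have pi0 := @pi_gt0 R.
      have := small a (b - pi *+ 2); rewrite /arc_joins -(cisD2pi (b - _)) subrK.
      have -> : a <= b - pi *+ 2 by lra.
      by move=> /(_ (conj isT jn)); lra.
    have := small b (a + pi *+ 2); rewrite /arc_joins cisD2pi.
    have -> : b <= a + pi *+ 2 by lra.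
    have jn' : cis b = v /\ cis a = y \/ cis b = y /\ cis a = v by tauto.
    by move=> /(_ (conj isT jn')); lra.
  have {}bapi : b - a < pi.
    rewrite lt_neqAle bapi andbT; apply: contra yv => /eqP bapi'.
    have e : cis b = - cis a by rewrite -cisDpi -bapi' subrKC.
    by case: jn => -[<- <-]; rewrite e ?opprK.
  case: jn => -[<- <-]; last apply: arc_weightsC.
    exact: arc_weights_sub.
  exact: arc_weights_sub.
move=> vyw.
have [a _ va] := polar v1.
have [d /andP[d1 d2] yd] := polar_from a y1.
have {}d2 : d < pi.
  rewrite lt_neqAle d2 andbT; apply: contra yv => /eqP dpi.
  by rewrite yd va dpi cisDpi.
(* The angle [d] from [v] to [y] lies strictly between [- pi] and [pi]; its sign decides at which of
   the two points the shortest arc starts. *)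
have [d0|d0] := leP 0 d.
  exists a, (a + d); split.
  - by split; [rewrite lerDl|left].
  - move=> a' b'; rewrite addrC addKr va yd; apply: smallest_arc_from.
    by rewrite d0.
  - by apply: weights_arc => //; rewrite ?d0// -va -yd.
have e0 : 0 <= - d < pi by lra.
have va' : v = cis (a + d + - d) by rewrite addrK.
exists (a + d), (a + d + - d); split.
- by split; [lra|right].
- move=> a' b' [ab' jn]; have := @smallest_arc_from (a + d) (- d) e0 a' b'.
  rewrite -va' -yd => /(_ _); rewrite (_ : a + d - d - (a + d) = - d); last by ring.
  by apply; split=> //; tauto.
- by apply: weights_arc => //; rewrite -va' -yd; exact: arc_weightsC.
Qed.

End plane.

(** * Iterated hyperaddition *)

Section hypersum.
Context (R : realType).
Local Notation F := (phase R).
Local Notation o := (phase0 R).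
Implicit Types (s : seq F) (x y v w : F) (m a b c : R) (z : R[i]).

Lemma phase_val0 x : (val x == 0) = (x == o).
Proof. by apply/eqP/eqP => [e|->//]; exact: val_inj. Qed.

Lemma phase_sqn x : x != o -> sqn (val x) = 1.
Proof.
move=> x0; have [e|/norm1_sqn//] := set_mem (valP x).
by move: x0; rewrite -phase_val0 e eqxx.
Qed.

Lemma phase_of_subproof z : sqn z = 1 -> z \in @phase_set R.
Proof. by move=> /sqn_norm1 z1; rewrite inE; right. Qed.

Definition phase_of z (z1 : sqn z = 1) : F := SigSub (phase_of_subproof z1).

Lemma normalize z : z != 0 -> exists2 c, 0 < c & exists2 v, v != o & z = c%:C * val v.
Proof.
move=> z0; have c0 : 0 < Num.sqrt (sqn z).
  rewrite sqrtr_gt0 lt_neqAle sqn_ge0 andbT eq_sym.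
  by apply: contra z0 => /eqP/sqn_eq0 ->.
have v1 : sqn ((Num.sqrt (sqn z))^-1%:C * z) = 1.
  by rewrite sqnZ exprVn sqr_sqrtr ?sqn_ge0// mulVf// gt_eqF// -sqrtr_gt0.
exists (Num.sqrt (sqn z)) => //; exists (phase_of v1).
  by rewrite -phase_val0 sqn1_neq0.
rewrite /= mulrA -rmorphM mulfV ?gt_eqF//; last by rewrite mul1r.
Qed.

(* Weights vanish at zero entries, hence also at out-of-range indices, where
   [nth] returns [o]. *)
Definition comb s m z := exists l : nat -> R,
  [/\ forall i, 0 <= l i, forall i, nth o s i = o -> l i = 0,
      \sum_(i < size s) l i = m & \sum_(i < size s) (l i)%:C * val (nth o s i) = z].

Lemma comb0 s : comb s 0 0.
Proof.
exists (fun=> 0); split => //; first by rewrite big1.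
by rewrite big1// => i _; rewrite mul0r.
Qed.

Lemma comb_ge0 s m z : comb s m z -> 0 <= m.
Proof. by move=> [l [l0 _ <- _]]; apply: sumr_ge0. Qed.

Lemma comb_m0 s z : comb s 0 z -> z = 0.
Proof.
move=> [l [l0 _ /eqP + <-]]; rewrite psumr_eq0// => /allP h.
rewrite big1// => i _; have := h i; rewrite mem_index_enum => /(_ isT)/eqP ->.
by rewrite mul0r.
Qed.

Lemma combZ s c m z : 0 <= c -> comb s m z -> comb s (c * m) (c%:C * z).
Proof.
move=> c0 [l [l0 lz <- <-]]; exists (fun i => c * l i); split.
- by move=> i; rewrite mulr_ge0.
- by move=> i /lz ->; rewrite mulr0.
- by rewrite mulr_sumr.
- by rewrite mulr_sumr; apply: eq_bigr => i _; rewrite rmorphM mulrA.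
Qed.

Lemma comb_rcons s y m z : comb (rcons s y) m z <->
  exists a, [/\ 0 <= a, y = o -> a = 0 & comb s (m - a) (z - a%:C * val y)].
Proof.
split.
  move=> [l [l0 lz <- <-]]; exists (l (size s)); split => //.
    by move=> y0; apply: lz; rewrite nth_rcons ltnn eqxx.
  exists (fun i => if (i < size s)%N then l i else 0); split.
  - by move=> i; case: ifP.
  - move=> i si; case: ifP => // ilt; apply: lz.
    by rewrite nth_rcons ilt.
  - by rewrite size_rcons big_ord_recr/= addrK; apply: eq_bigr => i _; rewrite ltn_ord.
  - rewrite size_rcons big_ord_recr/= nth_rcons ltnn eqxx addrK.
    by apply: eq_bigr => i _; rewrite ltn_ord nth_rcons ltn_ord.
move=> [a [a0 ya [l [l0 lz em ez]]]].
exists (fun i => if (i < size s)%N then l i else if i == size s then a else 0).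
split.
- by move=> i; case: ifP => // _; case: ifP.
- move=> i; rewrite nth_rcons; case: ifP => [_ /lz//|_].
  by case: ifP => // _ /ya.
- rewrite size_rcons big_ord_recr/= ltnn eqxx.
  by under eq_bigr do rewrite ltn_ord; rewrite em subrK.
- rewrite size_rcons big_ord_recr/= ltnn eqxx nth_rcons ltnn eqxx.
  by under eq_bigr do rewrite ltn_ord nth_rcons ltn_ord; rewrite ez subrK.
Qed.

Lemma comb_mem s x : x \in s -> x != o -> comb s 1 (val x).
Proof.
move=> xs x0; have xi : (index x s < size s)%N by rewrite index_mem.
exists (fun i => (i == index x s)%:R); split.
- by move=> i; rewrite ler0n.
- move=> i si; case: eqP => // e; move: x0.
  by rewrite -(nth_index o xs) -e si eqxx.
- by rewrite (bigD1 (Ordinal xi))//= eqxx big1 ?addr0// => i /negbTE /=; rewrite -val_eqE => ->.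
- rewrite (bigD1 (Ordinal xi))//= eqxx mul1r nth_index// big1 ?addr0// => i.
  by rewrite -val_eqE => /negbTE /= ->; rewrite mul0r.
Qed.

Lemma comb_all0 s m z : all (pred1 o) s -> comb s m z -> m = 0.
Proof.
move=> /allP s0 [l [_ lz <- _]]; apply: big1 => i _; apply: lz.
by apply/eqP/s0/mem_nth.
Qed.

Definition balanced s := exists2 m, 0 < m & comb s m 0.

(* Reversibility of the hyperaddition: [w] is in the hypersum of [s] iff [0] is in
   the hypersum of [s] and [- w], that is, [0] is a conical combination of them. *)
Definition in_hull s w :=
  if w == o then balanced s \/ all (pred1 o) s
  else exists m c, [/\ 0 < m, 0 <= c & comb s m (c%:C * val w)].

(** For antipodal [v] and [y] the weights 1, 1, 0 put every nonzero [w] into [arc_weights], so one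
    conical formula covers both the antipodal and the arc case. *)
Lemma phase_addP v y w : v != o -> y != o -> phase_add v y w <->
  if w == o then val y = - val v else arc_weights (val v) (val y) (val w).
Proof.
move=> v0 y0; rewrite /phase_add (negbTE v0) (negbTE y0).
have [v1 y1] := (phase_sqn v0, phase_sqn y0).
have [yv|yv] := eqVneq (val y) (- val v).
  split=> [_|//]; case: ifP => // _.
  exists 1, 1, 0; rewrite ler01 lexx addr_gt0// yv; split => //.
  by rewrite mulrN addrN mul0r.
have [->|w0] := eqVneq w o.
  split=> [/= [a [b [_ _ [t _ e]]]]|/eqP]; last by rewrite (negbTE yv).
  by have := sqn_cis t; rewrite e /sqn /= expr0n/= addr0 => /eqP; rewrite eq_sym oner_eq0.
exact: smallest_arcP v1 y1 (phase_sqn w0) yv.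
Qed.

Lemma in_hull_nil w : in_hull [::] w <-> w = o.
Proof.
rewrite /in_hull; have [->|w0] := eqVneq w o; first by split=> // _; right.
split=> [[m [c [m0 _ [l [_ _ e _]]]]]|e]; last by rewrite e eqxx in w0.
by move: m0; rewrite -e big_ord0 ltxx.
Qed.

Lemma in_hull_rcons0 s w : in_hull (rcons s o) w <-> in_hull s w.
Proof.
have E m z : comb (rcons s o) m z <-> comb s m z.
  rewrite comb_rcons; split.
    by move=> [a [_ /(_ erefl) ->]]; rewrite subr0 mul0r subr0.
  by move=> h; exists 0; rewrite subr0 mul0r subr0.
rewrite /in_hull all_rcons /= eqxx /=; case: ifP => _.
  by split=> -[[m m0 /E]|]; [left; exists m|right|left; exists m|right].
by split=> -[m [c [m0 c0 /E]]]; exists m, c.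
Qed.

(** From a combination of [rcons s y] with value [C w], the part [u] carried by [s] is [C w - a y].
    Its direction is the required [v]; the other cases handle a [u] without direction. *)
Lemma in_hull_step s y w : y != o -> in_hull (rcons s y) w ->
  exists2 v, in_hull s v & phase_add v y w.
Proof.
move=> y0; have y1 := phase_sqn y0.
have Ny1 : sqn (- val y) = 1 by rewrite sqnN.
(* The hypersum of [- y] and [y] is all of the hyperfield, so [- y] serves whenever it lies in the
   hull of [s]. *)
pose Ny := phase_of Ny1.
have Ny0 : Ny != o by rewrite -phase_val0 sqn1_neq0.
have addNy u : phase_add Ny y u.
  by rewrite /phase_add (negbTE y0) (negbTE Ny0) /= opprK eqxx.
have [->|w0] := eqVneq w o.
  rewrite {1}/in_hull eqxx => -[[M M0]|]; last first.
    by rewrite all_rcons /= (negbTE y0).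
  rewrite comb_rcons => -[a [a0 _ cs]]; exists Ny => //.
  rewrite /in_hull (negbTE Ny0); exists (M - a), a; split => //.
    rewrite lt_neqAle (comb_ge0 cs) andbT; apply: contraTneq M0 => e.
    move: cs; rewrite -e => /comb_m0 /eqP; rewrite sub0r oppr_eq0 mulf_eq0.
    rewrite phase_val0 (negbTE y0) orbF eq_complex /= eqxx andbT => /eqP a00.
    by rewrite -[M](subrK a) -e a00 addr0 ltxx.
  by move: cs; rewrite sub0r mulrN.
rewrite {1}/in_hull (negbTE w0) => -[M [C [M0 C0]]].
rewrite comb_rcons => -[a [a0 _ cs]].
set m := M - a in cs; set u := _ - _ in cs.
have [s0|] := boolP (all (pred1 o) s).
  exists o; first by rewrite /in_hull eqxx; right.
  have m0 : m = 0 by exact: comb_all0 s0 cs.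
  move: cs; rewrite m0 => /comb_m0 /eqP; rewrite subr_eq0 => /eqP e.
  rewrite /phase_add (negbTE y0) eqxx /=; apply: val_inj.
  apply/esym/(unit_scale_inj y1 (phase_sqn w0) _ C0 (esym e)).
  by move: M0; rewrite -(subrK a M) -/m m0 add0r.
move=> /allPn[x xs /= x0].
have [u0|u0] := eqVneq u 0; last first.
  have [c c0 [v v0 uv]] := normalize u0; exists v.
    rewrite /in_hull (negbTE v0); exists m, c; split; [|exact: ltW|by rewrite -uv].
    rewrite lt_neqAle (comb_ge0 cs) andbT; apply: contraNneq u0 => e.
    by move: cs; rewrite -e => /comb_m0 ->.
  apply/(phase_addP _ v0 y0); rewrite (negbTE w0).
  exists c, a, C; split => //; [exact: ltW|exact: ltr_pwDl|].
  by rewrite -uv /u subrK.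
move: cs; rewrite u0 => cs.
(* Here [s] has a vanishing combination of positive weight, so every nonzero phase, in particular
   [- y], is in its hull with coefficient 0. *)
have [m0|m0] := eqVneq m 0; last first.
  exists Ny => //; rewrite /in_hull (negbTE Ny0); exists m, 0; rewrite lexx mul0r.
  by split => //; rewrite lt_neqAle eq_sym m0 (comb_ge0 cs).
have a_gt0 : 0 < a by move: M0; rewrite -(subrK a M) -/m m0 add0r.
have yw : y = w.
  move/eqP: u0; rewrite subr_eq0 => /eqP e; apply: val_inj.
  exact: unit_scale_inj y1 (phase_sqn w0) a_gt0 C0 (esym e).
(* All weight sits on [y], hence [w = y], and [y] is an endpoint of the arc from any nonzero entry
   [x] of [s]. *)
exists x.
  rewrite /in_hull (negbTE x0); exists 1, 1; rewrite ltr01 ler01 mul1r.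
  by split => //; exact: comb_mem.
apply/(phase_addP _ x0 y0); rewrite (negbTE w0) yw.
by exists 0, 1, 1; rewrite lexx ler01 add0r ltr01 mul0r add0r.
Qed.

Lemma in_hull_step_conv s y v w : y != o -> in_hull s v -> phase_add v y w ->
  in_hull (rcons s y) w.
Proof.
move=> y0; have y1 := phase_sqn y0.
have [->|v0] := eqVneq v o.
  move=> _; rewrite /phase_add (negbTE y0) eqxx /= => ->.
  rewrite /in_hull (negbTE y0); exists 1, 1; rewrite ltr01 ler01; split => //.
  apply/comb_rcons; exists 1; rewrite ler01 !subrr; split => //.
    by move=> e; rewrite e eqxx in y0.
  exact: comb0.
have ya a : y = o -> a = 0 by move=> e; rewrite e eqxx in y0.
rewrite {1}/in_hull (negbTE v0) => -[m [c [m0 c0 cs]]].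
move=> /(phase_addP _ v0 y0); rewrite /in_hull.
case: ifP => [_ yv|/negbT w0].
  left; exists (m + c); first exact: ltr_pwDl.
  apply/comb_rcons; exists c; split; [by []|exact: ya|].
  by rewrite addrK sub0r yv mulrN opprK.
move=> [a [b [g [a0 b0 g0 ab e]]]].
(* This case is separate because the total weight [a * m + c * b] used below could vanish when
   [a = 0] and [c = 0]. *)
have [a00|a_neq0] := eqVneq a 0.
  exists b, g; split => //; first by rewrite a00 add0r in ab.
  apply/comb_rcons; exists b; split; [by []|exact: ya|].
  by rewrite -e a00 mul0r add0r !subrr; exact: comb0.
have a_gt0 : 0 < a by rewrite lt_neqAle eq_sym a_neq0.
(* Multiply [a v + b y = g w] by [c] and replace [c v] by its combination of [s], of total weight
   [m]. *)
exists (a * m + c * b), (c * g); split.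
- by rewrite ltr_pwDl ?mulr_ge0 ?mulr_gt0.
- exact: mulr_ge0.
- apply/comb_rcons; exists (c * b); split; [exact: mulr_ge0|exact: ya|].
  rewrite addrK !rmorphM -mulrA -e.
  have -> : c%:C * (a%:C * val v + b%:C * val y) - (c%:C * b%:C) * val y =
    a%:C * (c%:C * val v) by ring.
  exact: combZ.
Qed.

Lemma in_hull_rcons s y w : in_hull (rcons s y) w <->
  exists2 v, in_hull s v & phase_add v y w.
Proof.
have [->|y0] := eqVneq y o.
  rewrite in_hull_rcons0 /phase_add eqxx.
  by split=> [?|[v ? ->//]]; exists w.
by split; [exact: in_hull_step|move=> [v]; exact: in_hull_step_conv].
Qed.

Lemma foldl_in_hull s t : foldl (fun A y => \bigcup_(w in A) phase_add w y)
  (in_hull s) t = in_hull (s ++ t).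
Proof.
elim: t s => [|y t IH] s /=; first by rewrite cats0.
rewrite -cat_rcons -IH; congr foldl.
by apply/seteqP; split=> w /=; rewrite in_hull_rcons => -[v ? ?]; exists v.
Qed.

Lemma phase_sumP x s : phase_sum (x :: s) o <-> balanced (x :: s) \/ all (pred1 o) (x :: s).
Proof.
have -> : phase_sum (x :: s) = in_hull (x :: s).
  rewrite -cat1s -foldl_in_hull /=; congr foldl.
  apply/seteqP; split=> w /=.
    move=> ->; apply/(in_hull_rcons [::]); exists o; first exact/in_hull_nil.
    by rewrite /phase_add eqxx; case: eqVneq.
  move=> /(in_hull_rcons [::])[v /in_hull_nil ->].
  by rewrite /phase_add eqxx; case: eqVneq => [->|].
by rewrite /in_hull eqxx.
Qed.

End hypersum.

(** * Compactness and the polar criterion *)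

Section complex_topology.
Context (R : realType).

Lemma Re_continuous : continuous (fun z : R[i] => Re z).
Proof.
move=> z U /nbhs_ballP[e /= e0 eU]; apply/nbhs_ballP.
exists e%:C => /=; first by rewrite ltcR.
move=> w zw; apply: eU; move: zw.
change (`|z - w| < e%:C -> `|Re z - Re w| < e).
by rewrite -ltcR -ReN -ReD; apply: le_lt_trans; exact: normc_ge_Re.
Qed.

Lemma norm_i : `|'i : R[i]| = 1.
Proof. by apply: sqn_norm1; rewrite /sqn /= expr0n expr1n add0r. Qed.

Lemma mulNi_Re (z : R[i]) : Re (- 'i * z) = Im z.
Proof. by case: z => x y /=; ring. Qed.

Lemma Im_continuous : continuous (fun z : R[i] => Im z).
Proof.
move=> z U /nbhs_ballP[e /= e0 eU]; apply/nbhs_ballP.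
exists e%:C => /=; first by rewrite ltcR.
move=> w zw; apply: eU; move: zw.
change (`|z - w| < e%:C -> `|Im z - Im w| < e).
rewrite -ltcR -ImN -ImD; apply: le_lt_trans; rewrite -mulNi_Re.
by apply: le_trans (normc_ge_Re _) _; rewrite normrM normrN norm_i mul1r.
Qed.

Lemma complex_continuous (T : topologicalType) (f : T -> R[i]) :
  continuous (fun x => Re (f x)) -> continuous (fun x => Im (f x)) -> continuous f.
Proof.
move=> cR cI x U /nbhs_ballP[e /= e0 eU].
have [er e0'] : e = (Re e)%:C /\ 0 < Re e.
  by move: e0; rewrite ltcE /= => /andP[/eqP Ie ?]; split=> //; exact: complex_ext.
have e20 : 0 < Re e / 2 by rewrite divr_gt0.
have : \forall y \near x, `|Re (f x) - Re (f y)| < Re e / 2.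
  by have /cvgrPdist_lt := cR x; apply.
have : \forall y \near x, `|Im (f x) - Im (f y)| < Re e / 2.
  by have /cvgrPdist_lt := cI x; apply.
apply: filterS2 => y yI yR; apply: eU.
change (`|f x - f y| < e); rewrite [f x - f y]complexE er.
apply: le_lt_trans (ler_normD _ _) _.
rewrite normrM norm_i mul1r !normc_def /= expr0n /= !addr0 !sqrtr_sqr -rmorphD ltcR.
rewrite ReD ReN ImD ImN (splitr (Re e)); exact: ltrD.
Qed.

Lemma cis_continuous : continuous (@cis R).
Proof.
by apply: complex_continuous; [exact: continuous_cos|exact: continuous_sin].
Qed.

Lemma phase_set_compact : compact (@phase_set R).
Proof.
have -> : @phase_set R = [set 0] `|` @cis R @` `[- pi, pi].
  apply/seteqP; split => z /=.
    move=> [->|/norm1_sqn/polar[t /andP[t1 t2] ->]]; [by left|right; exists t => //].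
    by rewrite /= in_itv/= ltW.
  by move=> [->|[t _ <-]]; [left|right; apply/sqn_norm1/sqn_cis].
apply: compactU; first exact: compact_set1.
apply: continuous_compact; last exact: segment_compact.
exact/continuous_subspaceT/cis_continuous.
Qed.

Lemma phase_compact : compact [set: phase R].
Proof. exact/compact_set_type/phase_set_compact. Qed.

Lemma phase_val_continuous : continuous (val : phase R -> R[i]).
Proof. exact: initial_continuous. Qed.

Lemma sqn_continuous : continuous (@sqn R).
Proof.
move=> z; have [cR cI] := (@Re_continuous z, @Im_continuous z).
exact: (cvgD (cvgM cR cR) (cvgM cI cI)).
Qed.

Lemma phase_sqn_continuous : continuous (fun x : phase R => sqn (val x)).
Proof.
move=> x; apply: (@continuous_comp _ _ _ (val : phase R -> R[i]) (@sqn R)).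
  exact: phase_val_continuous.
exact: sqn_continuous.
Qed.

End complex_topology.

(** * Gordan's alternative and the half-plane form of the hypersum condition *)

Section polar_criterion.
Context (R : realType).

Definition dot (u z : R[i]) : R := Re u * Re z + Im u * Im z.

Lemma dotZr u a z : dot u (a%:C * z) = a * dot u z.
Proof. by rewrite /dot ReZ ImZ; ring. Qed.

Lemma dot_sumr u (I : finType) (F : I -> R[i]) :
  dot u (\sum_i F i) = \sum_i dot u (F i).
Proof. by rewrite /dot Re_sum Im_sum !mulr_sumr -big_split. Qed.

Lemma sqnD z w : sqn (z + w) = sqn z + dot z w *+ 2 + sqn w.
Proof. by rewrite /sqn /dot ReD ImD; ring. Qed.

Lemma dot_continuous u : continuous (dot u).
Proof.
move=> z; have [cR cI] := (@Re_continuous R z, @Im_continuous R z).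
exact: (cvgD (cvgM (cvg_cst (Re u)) cR) (cvgM (cvg_cst (Im u)) cI)).
Qed.

Lemma simplex_set_compact k : compact (@simplex_set R k).
Proof.
apply: (@subclosed_compact _ _ [set f : {ptws 'I_k.+1 -> R} | forall i, `[0, 1]%classic (f i)]).
- have -> : @simplex_set R k =
    (\bigcap_(i in [set: 'I_k.+1])
       (fun f : {ptws 'I_k.+1 -> R} => f i) @^-1` [set x | 0 <= x]) `&`
      (fun f : {ptws 'I_k.+1 -> R} => \sum_i f i) @^-1` [set 1].
    apply/seteqP; split => f /=; first by move=> [f0 f1]; split => // i _; exact: f0.
    by move=> [f0 f1]; split => // i; exact: (f0 i I).
  apply: closedI.
    apply: closed_bigI => i _; apply: preimage_closed; last exact: closed_ge.
    by move=> f _; exact: proj_continuous.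
  apply: preimage_closed; last exact: closed_eq.
  by move=> f _; apply: sum_continuous => i; exact: proj_continuous.
- by apply: (@tychonoff _ (fun=> R) (fun=> `[0, 1]%classic)) => i; exact: segment_compact.
- move=> f [f0 f1] i /=; rewrite in_itv/= f0 -f1 (bigD1 i)//= lerDl.
  exact: sumr_ge0.
Qed.

Lemma linear_form_continuous k (c : 'I_k.+1 -> R) :
  continuous (fun l : {ptws 'I_k.+1 -> R} => \sum_i l i * c i).
Proof.
move=> l; apply: (@sum_continuous _ _ _ _ _ (fun i (l : {ptws 'I_k.+1 -> R}) => l i * c i)) => i.
apply: (@continuous_comp _ _ _ (fun l : {ptws 'I_k.+1 -> R} => l i) (fun r : R => r * c i)).
  exact: proj_continuous.
exact: (cvgM cvg_id (cvg_cst (c i))).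
Qed.

(* Gordan's alternative: minimize the norm over the convex hull of the [z i],
   [i] in [A]. *)
Lemma gordan k (A : pred 'I_k.+1) (z : 'I_k.+1 -> R[i]) :
  (forall u, exists2 i, A i & 0 <= dot u (z i)) ->
  exists l : 'I_k.+1 -> R, [/\ forall i, 0 <= l i, forall i, ~~ A i -> l i = 0,
    \sum_i l i = 1 & \sum_i (l i)%:C * z i = 0].
Proof.
move=> pol.
pose S := @simplex_set R k `&` [set l | forall i, ~~ A i -> l i = 0].
pose delta (i : 'I_k.+1) : {ptws 'I_k.+1 -> R} := fun j => (i == j)%:R.
have sdelta i (F : 'I_k.+1 -> R) : \sum_j delta i j * F j = F i.
  rewrite (bigD1 i)//= /delta eqxx mul1r big1 ?addr0// => j.
  by rewrite eq_sym => /negbTE ->; rewrite mul0r.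
have Sdelta i : A i -> S (delta i).
  move=> Ai; split; last first.
    by move=> j /=; rewrite /delta; case: (eqVneq i j) => // <-; rewrite Ai.
  split=> [j|]; first by rewrite ler0n.
  by rewrite -[RHS](sdelta i (fun=> 1)); apply: eq_bigr => j _; rewrite mulr1.
pose f (l : {ptws 'I_k.+1 -> R}) := sqn (\sum_i (l i)%:C * z i).
have cf : continuous f.
  move=> l; apply: (@continuous_comp _ _ _
    (fun l : {ptws 'I_k.+1 -> R} => \sum_i (l i)%:C * z i) (@sqn R));
    last exact: sqn_continuous.
  apply: complex_continuous => {}l.
    rewrite (_ : (fun _ => _) =
      fun l : {ptws 'I_k.+1 -> R} => \sum_i l i * Re (z i)); last first.
      by apply/funext => y; rewrite Re_sum; apply: eq_bigr => i _; rewrite ReZ.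
    exact: linear_form_continuous.
  rewrite (_ : (fun _ => _) =
      fun l : {ptws 'I_k.+1 -> R} => \sum_i l i * Im (z i)); last first.
      by apply/funext => y; rewrite Im_sum; apply: eq_bigr => i _; rewrite ImZ.
    exact: linear_form_continuous.
have cS : compact S.
  apply: compact_closedI; first exact: simplex_set_compact.
  have -> : [set l : {ptws 'I_k.+1 -> R} | forall i, ~~ A i -> l i = 0] =
    \bigcap_(i in [set i | ~~ A i]) (fun l : {ptws 'I_k.+1 -> R} => l i) @^-1` [set 0].
    by apply/seteqP; split => l h i; exact: h.
  apply: closed_bigI => i _; apply: preimage_closed; last exact: closed_eq.
  by move=> l _; exact: proj_continuous.
have [i0 Ai0 _] := pol 0.
have S0 : S !=set0 by exists (delta i0); exact: Sdelta.
have [l /set_mem[[l0 l1] lA] lmin] := compact_EVT_min S0 cS (continuous_subspaceT cf).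
exists l; split => //; set v := \sum_i _.
apply: sqn_eq0; apply/eqP; rewrite eq_le sqn_ge0 andbT leNgt; apply/negP => V0.
(* A nonzero minimizer [v] has a vertex [z i] with [dot v (z i) <= 0]; moving from [v] towards it
   shortens the vector. *)
have [i Ai ui] := pol (- v).
have {}ui : dot v (z i) <= 0 by move: ui; rewrite /dot ReN ImN; lra.
pose W := sqn (z i); have W0 : 0 <= W := sqn_ge0 _.
(* This [e] minimizes [(1 - e) ^+ 2 * sqn v + e ^+ 2 * W], with minimum [(1 - e) * sqn v]; the cross
   term is nonpositive. *)
pose e := sqn v / (sqn v + W).
have VW : 0 < sqn v + W by rewrite ltr_wpDr.
have e0 : 0 < e by rewrite divr_gt0.
have e1 : e <= 1 by rewrite ler_pdivrMr// mul1r lerDl.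
pose l' : {ptws 'I_k.+1 -> R} := fun j => (1 - e) * l j + e * delta i j.
have [[d0 d1] dA] := Sdelta i Ai.
have Sl' : S l'.
  split; last by move=> j Aj; rewrite /l' lA// dA// !mulr0 addr0.
  split=> [j|].
    by apply: addr_ge0; apply: mulr_ge0; [rewrite subr_ge0|exact: l0|exact: ltW|exact: d0].
  by rewrite /l' big_split/= -!mulr_sumr l1 d1 !mulr1 subrK.
have := lmin l' (mem_set Sl'); rewrite /f -/v.
have -> : \sum_j (l' j)%:C * z j = (1 - e)%:C * v + e%:C * z i.
  have -> : z i = \sum_j (delta i j)%:C * z j.
    rewrite (bigD1 i)//= /delta eqxx mul1r big1 ?addr0// => j.
    by rewrite eq_sym => /negbTE ->; rewrite mul0r.
  rewrite /v !mulr_sumr -big_split/=; apply: eq_bigr => j _.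
  by rewrite /l' rmorphD !rmorphM/=; ring.
rewrite sqnD !sqnZ dotZr -/W.
have -> : dot ((1 - e)%:C * v) (z i) = (1 - e) * dot v (z i).
  by rewrite /dot ReZ ImZ; ring.
have eV : e * (sqn v + W) = sqn v by rewrite /e divfK// gt_eqF.
have D0 : e * ((1 - e) * dot v (z i)) <= 0.
  apply: mulr_ge0_le0; first exact: ltW.
  by apply: mulr_ge0_le0 => //; rewrite subr_ge0.
clearbody e; clearbody W; move=> h.
have key : (1 - e) ^+ 2 * sqn v + e ^+ 2 * W = sqn v - e * sqn v.
  transitivity (sqn v - 2 * e * sqn v + e * (e * (sqn v + W))); first by ring.
  by rewrite eV; ring.
have := mulr_gt0 e0 V0; rewrite mulr2n in h; lra.
Qed.

(* By [gordan], [0] lies in the convex hull of the nonzero [x i]; this form shows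
   that the condition is closed. *)
Definition polar_balanced (I : finType) (x : I -> phase R) :=
  forall u, exists2 i, x i != phase0 R & 0 <= dot u (val (x i)).

(** If every nonzero entry had negative product with [u], pairing the vanishing combination with [u]
    would give a zero sum of nonpositive terms, forcing all weights to be 0. The converse is
    [gordan]. *)
Lemma balanced_polar k (x : 'I_k.+1 -> phase R) :
  balanced [seq x i | i <- enum 'I_k.+1] <-> polar_balanced x.
Proof.
set s := map _ _; have ss : size s = k.+1 by rewrite size_map size_enum_ord.
have sn (i : 'I_k.+1) : nth (phase0 R) s i = x i.
  by rewrite (nth_map ord0) ?size_enum_ord ?ltn_ord// nth_ord_enum.
split.
  move=> [m m0 [l [l0 lz em ez]]] u; apply: contrapT => hu.
  have {}hu (i : 'I_k.+1) : l i != 0 -> dot u (val (x i)) < 0.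
    move=> li; rewrite ltNge; apply/negP => di; apply: hu; exists i => //.
    by apply: contra li => /eqP xi; rewrite lz// sn.
  rewrite ss in em ez.
  have h (i : 'I_k.+1) : l i * dot u (val (x i)) <= 0.
    by have [->|/hu/ltW ?] := eqVneq (l i) 0; rewrite ?mul0r// mulr_ge0_le0.
  have : \sum_(i < k.+1) l i * dot u (val (x i)) = 0.
    transitivity (dot u (\sum_(i < k.+1) (l i)%:C * val (nth (phase0 R) s i))).
      by rewrite dot_sumr; apply: eq_bigr => i _; rewrite dotZr sn.
    by rewrite ez /dot /= !mulr0 addr0.
  move=> /eqP; rewrite -oppr_eq0 -sumrN psumr_eq0; last by move=> i _; rewrite oppr_ge0.
  move=> /allP e; move: m0; rewrite -em big1 ?ltxx// => i _.
  have := e i; rewrite mem_index_enum => /(_ isT); rewrite /= oppr_eq0 mulf_eq0.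
  move=> /orP[/eqP//|/eqP d0]; apply/eqP; apply: contraT => /hu.
  by rewrite d0 ltxx.
move=> /(@gordan k (fun i => x i != phase0 R))[l [l0 lz l1 lx]].
exists 1; first exact: ltr01.
exists (fun i => if insub i is Some j then l j else 0); split.
- by move=> i; case: insubP.
- move=> i; case: insubP => // j _ <-; rewrite sn => xj; apply: lz.
  by rewrite xj eqxx.
- by rewrite ss -l1; apply: eq_bigr => i _; rewrite valK.
- by rewrite ss -[RHS]lx; apply: eq_bigr => i _; rewrite valK sn.
Qed.

(** The entry 1 in the last place rules out the all-zero alternative of [phase_sumP]. *)
Lemma ones_perp_last1P n (x : {ptws 'I_n.+1 -> phase R}) :
  ones_perp_last1 R n.+1 x <-> x ord_max = phase1 R /\ polar_balanced x.
Proof.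
have p10 : phase1 R != phase0 R.
  by rewrite -phase_val0 /= oner_eq0.
have E : x ord_max = phase1 R -> ones_perp R n.+1 x <-> polar_balanced x.
  move=> xm; rewrite -balanced_polar.
  change (phase_sum [seq x i | i <- enum 'I_n.+1] (phase0 R) <->
    balanced [seq x i | i <- enum 'I_n.+1]).
  have [y [s ss]] : exists y s, [seq x i | i <- enum 'I_n.+1] = y :: s.
    by rewrite enum_ordSl /=; do 2!eexists.
  rewrite ss phase_sumP -ss.
  split=> [[//|]|]; last by left.
  move=> /allP h; have : phase1 R \in [seq x i | i <- enum 'I_n.+1].
    by rewrite -xm; apply/map_f; rewrite mem_enum.
  by move=> /h /=; rewrite (negbTE p10).
split=> [[h1 h2]|[h1 h2]].
  by have xm := h2 ord_max erefl; split => //; apply/E.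
split; first exact/E.
by move=> i [im]; rewrite -h1; congr x; exact: val_inj.
Qed.

(** The point 0 is isolated from the circle. Without this the condition in [polar_balanced] would
    not be closed. *)
Lemma phase0_neq_closed : closed [set x : phase R | x != phase0 R].
Proof.
have -> : [set x : phase R | x != phase0 R] = (fun x => sqn (val x)) @^-1` [set 1].
  apply/seteqP; split => x /=; first exact: phase_sqn.
  by move=> /sqn1_neq0; rewrite phase_val0.
apply: preimage_closed; last exact: closed_eq.
by move=> x _; exact: phase_sqn_continuous.
Qed.

Lemma ones_perp_last1_closed n : closed (ones_perp_last1 R n.+1).
Proof.
have -> : ones_perp_last1 R n.+1 =
  (fun x : {ptws 'I_n.+1 -> phase R} => x ord_max) @^-1` [set phase1 R] `&`
  \bigcap_(u in [set: R[i]]) \bigcup_(i in [set: 'I_n.+1])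
   (fun x : {ptws 'I_n.+1 -> phase R} => x i) @^-1`
     ([set x : phase R | x != phase0 R] `&` [set x | 0 <= dot u (val x)]).
  apply/seteqP; split => x.
    move=> /ones_perp_last1P[h1 h2]; split => // u _.
    by have [i ? ?] := h2 u; exists i.
  move=> [h1 h2]; apply/ones_perp_last1P; split => // u.
  by have [i _ [? ?]] := h2 u I; exists i.
apply: closedI.
  apply: preimage_closed; first by move=> x _; exact: proj_continuous.
  exact: (accessible_closed_set1 (hausdorff_accessible (@phase_hausdorff R))).
apply: closed_bigI => u _.
apply: closed_bigcup; first exact: finite_finset.
move=> i _; apply: preimage_closed; first by move=> x _; exact: proj_continuous.
apply: closedI; first exact: phase0_neq_closed.
have -> : [set x : phase R | 0 <= dot u (val x)] =
  (fun x : phase R => dot u (val x)) @^-1` [set r | 0 <= r] by [].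
apply: preimage_closed; last exact: closed_ge.
move=> x _; apply: (@continuous_comp _ _ _ (val : phase R -> R[i]) (dot u)).
  exact: phase_val_continuous.
exact: dot_continuous.
Qed.

Lemma ones_perp_last1_compact n : compact (ones_perp_last1 R n.+1).
Proof.
apply: (@subclosed_compact _ _ [set f : {ptws 'I_n.+1 -> phase R} | forall i, setT (f i)]) => //.
  exact: ones_perp_last1_closed.
by apply: (@tychonoff _ (fun=> phase R) (fun=> setT)) => _; exact: phase_compact.
Qed.

End polar_criterion.

Section nerve_compact.
Context (d : Order.disp_t) (T : topPOrderType d) (k : nat).
Context (cT : compact [set: T]).

Lemma nerve_compact : compact [set: nerve T k].
Proof.
apply: compact_set_type.
apply: (@subclosed_compact _ _ [set f : {ptws 'I_k.+1 -> T} | forall i, setT (f i)]) => //.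
  have -> : @nerve_set d T k = \bigcap_(ij in [set ij : 'I_k.+1 * 'I_k.+1 | (ij.1 <= ij.2)%N])
    (fun f : {ptws 'I_k.+1 -> T} => (f ij.1, f ij.2)) @^-1` [set p : T * T | (p.1 <= p.2)%O].
    apply/seteqP; split => f /= h; first by move=> [i j] /= ij; exact: h.
    by move=> i j ij; exact: (h (i, j)).
  apply: closed_bigI => ij _; apply: preimage_closed; last exact: top_porder_closed.
  move=> f _.
    have c i : continuous (fun f : {ptws 'I_k.+1 -> T} => f i) by exact: proj_continuous.
    exact: (cvg_pair (c ij.1 f) (c ij.2 f)).
by apply: (@tychonoff _ (fun=> T) (fun=> setT)).
Qed.

Lemma simplex_compact (R : realType) : compact [set: simplex R k].
Proof. exact/compact_set_type/simplex_set_compact. Qed.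

End nerve_compact.

(** * Barycenters of chains *)

Section reduction.
Context (R : realType) (d : Order.disp_t) (T : topPOrderType d).
Implicit Types (k : nat).

Lemma simplex_ext k (t t' : simplex R k) : (forall i, val t i = val t' i) -> t = t'.
Proof. by move=> h; apply/val_inj/funext. Qed.

Lemma nerve_ext k (x x' : nerve T k) : (forall i, val x i = val x' i) -> x = x'.
Proof. by move=> h; apply/val_inj/funext. Qed.

Lemma nerve_le k (x : nerve T k) (i j : 'I_k.+1) : (i <= j)%N -> (val x i <= val x j)%O.
Proof. by move=> ij; apply: set_mem (valP x) i j ij. Qed.

Lemma simplex_ge0 k (t : simplex R k) i : 0 <= val t i.
Proof. by have [] := set_mem (valP t). Qed.

Lemma simplex_sum1 k (t : simplex R k) : \sum_i val t i = 1.
Proof. by have [] := set_mem (valP t). Qed.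

Definition reduced k (x : nerve T k) (t : simplex R k) :=
  (forall i, 0 < val t i) /\ (forall i j : 'I_k.+1, (i < j)%N -> val x i != val x j).

Lemma drop_vertex_subproof k (j : 'I_k.+2) (t : simplex R k.+1) :
  val t j = 0 -> (fun i => val t (lift j i)) \in @simplex_set R k.
Proof.
move=> tj; rewrite inE; split=> [i|]; first exact: simplex_ge0.
rewrite -(simplex_sum1 t) (bigD1_ord j)//= tj add0r.
by [].
Qed.

Definition drop_vertex k (j : 'I_k.+2) (t : simplex R k.+1) (tj : val t j = 0) :
  simplex R k := SigSub (drop_vertex_subproof tj).

Lemma drop_vertexK k (j : 'I_k.+2) (t : simplex R k.+1) (tj : val t j = 0) :
  simplex_map (lift j) (drop_vertex tj) = t.
Proof.
apply: simplex_ext => l /=; case: (unliftP j l) => [i ->|->].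
  by rewrite (big_pred1 i)// => i'; rewrite (inj_eq (@lift_inj _ _)).
by rewrite tj big_pred0// => i; rewrite eq_sym (negbTE (neq_lift _ _)).
Qed.

Lemma codegen_nerveK k (j : 'I_k.+1) (x : nerve T k.+1) :
  val x (widen_ord (leqnSn _) j) = val x (lift ord0 j) ->
  nerve_map (codegen_homo j) (nerve_map (lift_homo (widen_ord (leqnSn _) j)) x) = x.
Proof.
move=> xj; apply: nerve_ext => l /=.
have [lj|lj] := eqVneq (l : nat) j.
  have -> : l = widen_ord (leqnSn _) j by exact: val_inj.
  rewrite xj; congr (val x _); apply: val_inj.
  by rewrite /= /bump codegenE /unbump /= ltnn subn0 leqnn.
congr (val x _); apply: val_inj; rewrite /= /bump codegenE /unbump /=.
case: (ltngtP j l) lj => //= jl _; last by rewrite subn0 leqNgt jl.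
by rewrite subn1 -ltnS (ltn_predK jl) jl add1n (ltn_predK jl).
Qed.

(** Induction on the dimension: a vertex of weight 0 is removed by a face relation; two equal
    neighbours are merged, and their weights added, by a degeneracy relation. *)
Lemma reduce k (x : nerve T k) (t : simplex R k) : exists k' (x' : nerve T k') (t' : simplex R k'),
  reduced x' t' /\ realization_rel (realization_point x t) (realization_point x' t').
Proof.
elim: k x t => [|k IH] x t.
  exists 0%N, x, t; split; last exact: realization_rel_refl.
  split=> [i|i j]; last by rewrite !ord1.
  by have := simplex_sum1 t; rewrite big_ord1 (ord1 i) => ->.
have step k' (x' : nerve T k') t' (p : realization_sum R T) :
    realization_rel p (realization_point x' t') ->
    (exists k'' (x'' : nerve T k'') (t'' : simplex R k''), reduced x'' t'' /\
      realization_rel (realization_point x' t') (realization_point x'' t'')) ->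
    exists k'' (x'' : nerve T k'') (t'' : simplex R k''), reduced x'' t'' /\
      realization_rel p (realization_point x'' t'').
  move=> pq [k'' [x'' [t'' [r q]]]]; exists k'', x'', t''; split => //.
  exact: realization_rel_trans q.
have [[j tj]|t_neq0] := pselect (exists j, val t j = 0).
  apply: step (IH (nerve_map (lift_homo j) x) (drop_vertex tj)).
  rewrite realization_rel_sym -{2}(drop_vertexK tj).
  by apply/asboolP/rst_step; exact: face_step.
have [[j xj]|x_neq] := pselect (exists j : 'I_k.+1,
    val x (widen_ord (leqnSn _) j) = val x (lift ord0 j)).
  apply: step (IH (nerve_map (lift_homo (widen_ord (leqnSn _) j)) x)
    (simplex_map (codegen j) t)).
  rewrite -{1}(codegen_nerveK xj).
  by apply/asboolP/rst_step; exact: degen_step.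
exists k.+1, x, t; split; last exact: realization_rel_refl.
split=> [i|i j ij].
  by rewrite lt_neqAle simplex_ge0 andbT eq_sym; apply/eqP => ti; apply: t_neq0; exists i.
apply/eqP => xij; apply: x_neq.
have ik : (i < k.+1)%N by rewrite (leq_trans ij)// -ltnS.
(* A coincidence of entries [i < j] squeezes entry [i + 1] between them, so it already occurs
   between neighbours. *)
exists (Ordinal ik); apply/eqP; rewrite eq_le nerve_le//=.
have -> : widen_ord (leqnSn _) (Ordinal ik) = i by exact: val_inj.
by rewrite xij nerve_le.
Qed.

End reduction.

Section barycenters.
Context (R : realType) (n : nat).
Local Notation T := (ones_perp_last1 R n.+1 : topPOrderType _).
Local Notation o := (phase0 R).
Implicit Types (k : nat).

Definition entry k (x : nerve T k) (j : 'I_k.+1) (i : 'I_n.+1) : phase R :=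
  val (val x j) i.

Lemma entry_polar k (x : nerve T k) j : polar_balanced (entry x j).
Proof. by have /ones_perp_last1P[] := set_mem (valP (val x j)). Qed.

Lemma entry_last k (x : nerve T k) j : entry x j ord_max = phase1 R.
Proof. by have /ones_perp_last1P[] := set_mem (valP (val x j)). Qed.

Lemma phase1_neq0 : phase1 R != o.
Proof. by rewrite -phase_val0 /= oner_eq0. Qed.

(** Nonzero phases are maximal in the order, so along a chain a coordinate is 0 for a while and then
    keeps one fixed phase. *)
Lemma entry_le k (x : nerve T k) (j l : 'I_k.+1) i : (j <= l)%N ->
  entry x j i != o -> entry x l i = entry x j i.
Proof.
move=> /(nerve_le x)/lefP/(_ i) /predU1P[e _|/eqP e].
  by rewrite /entry e.
by rewrite /entry e eqxx.
Qed.

Lemma entry_neq0 k (x : nerve T k) (j l : 'I_k.+1) i : (j <= l)%N ->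
  entry x j i != o -> entry x l i != o.
Proof. by move=> jl xj; rewrite (entry_le jl xj). Qed.

Definition barycenter k (x : nerve T k) (t : simplex R k) i : R[i] :=
  \sum_j (val t j)%:C * val (entry x j i).

(** This is the modulus of coordinate [i] of the barycenter, since the nonzero entries of that
    coordinate all coincide. *)
Definition height k (x : nerve T k) (t : simplex R k) i : R :=
  \sum_(j | entry x j i != o) val t j.

Lemma barycenterE k (x : nerve T k) t i :
  barycenter x t i = (height x t i)%:C * val (entry x ord_max i).
Proof.
rewrite /height rmorph_sum mulr_suml /barycenter (bigID (fun j => entry x j i != o))/=.
rewrite [X in _ + X]big1 ?addr0; last first.
  by move=> j; rewrite negbK => /eqP ->; rewrite mulr0.
by apply: eq_bigr => j xj; rewrite (entry_le _ xj)// -ltnS.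
Qed.

Lemma height_ge0 k (x : nerve T k) t i : 0 <= height x t i.
Proof. by apply: sumr_ge0 => j _; exact: simplex_ge0. Qed.

Lemma height_le1 k (x : nerve T k) t i : height x t i <= 1.
Proof.
rewrite -(simplex_sum1 t) [leRHS](bigID (fun j => entry x j i != o))/= lerDl.
by apply: sumr_ge0 => j _; exact: simplex_ge0.
Qed.

Lemma sqn_barycenter k (x : nerve T k) t i : sqn (barycenter x t i) = height x t i ^+ 2.
Proof.
rewrite barycenterE sqnZ; have [x0|x0] := eqVneq (entry x ord_max i) o; last first.
  by rewrite phase_sqn ?mulr1.
rewrite /height big_pred0 ?expr0n/= ?mul0r// => j; apply/negbTE; rewrite negbK.
apply: contraTT isT => xj.
by have := entry_neq0 (_ : (j <= ord_max)%N) xj; rewrite x0 eqxx -ltnS ltn_ord => /(_ isT).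
Qed.

Lemma height_barycenter k (x : nerve T k) t i : height x t i = Num.sqrt (sqn (barycenter x t i)).
Proof. by rewrite sqn_barycenter sqrtr_sqr ger0_norm// height_ge0. Qed.

(** The last clause says that 0 is in the convex hull of the points of modulus 1, in the half-plane
    form of [polar_balanced]. *)
Definition boundary_config (z : 'I_n.+1 -> R[i]) :=
  [/\ z ord_max = 1, forall i, sqn (z i) <= 1 &
      forall u, exists2 i, sqn (z i) = 1 & 0 <= dot u (z i)].

Lemma barycenter_boundary k (x : nerve T k) t : boundary_config (barycenter x t).
Proof.
split.
- rewrite /barycenter; under eq_bigr do rewrite entry_last /= mulr1.
  by rewrite -rmorph_sum simplex_sum1.
- by move=> i; rewrite sqn_barycenter expr_le1 ?height_ge0// height_le1.
move=> u; have : exists j, val t j != 0.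
  apply: contrapT => h; have := simplex_sum1 t; rewrite big1 => [/eqP|j _].
    by rewrite eq_sym oner_eq0.
  by apply/eqP; apply: contrapT => tj; apply: h; exists j; exact/negP.
(* Take the first chain element of nonzero weight: its nonzero coordinates persist in every later
   element, and earlier ones carry no weight, so these coordinates have height 1. *)
move=> [j1 tj1]; case: (@arg_minnP _ j1 (fun j => val t j != 0) (@nat_of_ord _) tj1) => j tj jmin.
have [i xj di] := entry_polar x j u.
have h1 : height x t i = 1.
  rewrite -(simplex_sum1 t) [RHS](bigID (fun j => entry x j i != o))/=.
  rewrite [X in _ = _ + X]big1 ?addr0// => l /negP xl.
  apply/eqP; apply: contrapT => /negP tl; apply: xl.
  exact: entry_neq0 (jmin _ tl) xj.
exists i; first by rewrite sqn_barycenter h1 expr1n.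
by rewrite barycenterE h1 mul1r (entry_le _ xj)// -ltnS.
Qed.

Lemma barycenter_map m k (f : 'I_m.+1 -> 'I_k.+1) (hf : {homo f : i j / (i <= j)%N})
    (x : nerve T k) (t : simplex R m) :
  barycenter (nerve_map hf x) t = barycenter x (simplex_map f t).
Proof.
apply/funext => i; rewrite /barycenter (partition_big f xpredT)//=.
apply: eq_bigr => j _; rewrite rmorph_sum mulr_suml.
by apply: eq_bigr => l /eqP <-.
Qed.

Definition barycenter_of (p : realization_sum R T) : 'I_n.+1 -> R[i] :=
  barycenter (projT2 p).1 (projT2 p).2.

Lemma barycenter_of_rel p q : realization_rel p q -> barycenter_of p = barycenter_of q.
Proof.
move=> /asboolP; elim=> {p q} [p q []| | |] => //.
- by move=> k i x t; exact: barycenter_map.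
- by move=> k i x t; exact: barycenter_map.
- by move=> p q r _ -> _ ->.
Qed.

(** The height of a coordinate that first becomes nonzero at chain element [j]. The index is a
    natural number so that [k.+1] is allowed, with value 0. *)
Definition tail k (t : simplex R k) (j : nat) : R := \sum_(l < k.+1 | (j <= l)%N) val t l.

Lemma tailS k (t : simplex R k) (j : 'I_k.+1) : tail t j = val t j + tail t j.+1.
Proof.
rewrite /tail (bigD1 j)//=; congr (_ + _); apply: eq_bigl => l.
by rewrite [RHS]ltn_neqAle andbC eq_sym.
Qed.

Lemma tail_max k (t : simplex R k) : tail t k.+1 = 0.
Proof. by rewrite /tail big_pred0// => l; rewrite leqNgt ltn_ord. Qed.

Lemma height_tail k (x : nerve T k) t (j : 'I_k.+1) i : entry x j i != o ->
  (forall l : 'I_k.+1, (l < j)%N -> entry x l i = o) -> height x t i = tail t j.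
Proof.
move=> xj xl; apply: eq_bigl => l.
have [lj|jl] := ltnP l j; first by rewrite xl// eqxx.
exact: entry_neq0 jl xj.
Qed.

Section reduced_points.
Context k (x : nerve T k) (t : simplex R k) (red : reduced x t).

Lemma tail_lt (j l : nat) : (j < l <= k.+1)%N -> tail t l < tail t j.
Proof.
have S (i : nat) : (i < k.+1)%N -> tail t i.+1 < tail t i.
  by move=> ik; rewrite (tailS t (Ordinal ik)) ltrDr; case: red.
move=> /andP[]; elim: l => // l IH; rewrite ltnS leq_eqVlt => /predU1P[->|jl] lk.
  exact: S.
exact: lt_trans (S _ lk) (IH jl (ltnW lk)).
Qed.

(** Tails decrease strictly for a reduced point, so the modulus of a coordinate reveals the chain
    element from which it is nonzero. *)
Lemma entry_neq0_tail (j : 'I_k.+1) i : (entry x j i != o) = (tail t j <= height x t i).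
Proof.
apply/idP/idP => [xj|].
  rewrite /height [leRHS](bigID (fun l : 'I_k.+1 => (j <= l)%N))/=.
  rewrite -[leLHS]addr0 lerD//; last by apply: sumr_ge0 => l _; exact: simplex_ge0.
  rewrite le_eqVlt; apply/orP; left; apply/eqP; apply: eq_bigl => l.
  by apply/idP/andP => [jl|[]//]; split => //; exact: entry_neq0 jl xj.
apply: contraTneq => xj; rewrite -ltNge.
apply: (@le_lt_trans _ _ (tail t j.+1)); last by apply: tail_lt; rewrite leqnn/=.
rewrite /tail [leRHS](bigID (fun l => entry x l i != o))/=.
rewrite -[leLHS]addr0 lerD//; last by apply: sumr_ge0 => l _; exact: simplex_ge0.
rewrite le_eqVlt; apply/orP; left; apply/eqP; apply: eq_bigl => l.
apply/idP/andP => [xl|[]//]; split => //; rewrite ltnNge; apply/negP => lj.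
by have := entry_neq0 lj xl; rewrite xj eqxx.
Qed.

(** For [j = 0] the last coordinate, constantly 1, serves. For [j > 0] strictness of the chain gives
    a coordinate that turns nonzero exactly at [j]. *)
Lemma tail_height (j : 'I_k.+1) : exists i, height x t i = tail t j.
Proof.
case: j => -[|j] jk.
  exists ord_max; apply: height_tail => //; first by rewrite entry_last phase1_neq0.
pose j' := Ordinal (ltnW jk : (j < k.+1)%N).
have : exists i, entry x (Ordinal jk) i != entry x j' i.
  apply: contrapT => h; have [_ /(_ j' (Ordinal jk) (ltnSn _))] := red.
  apply/negP; rewrite negbK; apply/eqP/val_inj/funext => i.
  apply/esym/eqP; apply: contrapT => /negP ?; apply: h; by exists i.
move=> [i xi]; exists i; apply: height_tail.
  apply: contra xi => /eqP xj; apply/eqP; rewrite xj.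
  apply/esym/eqP; apply: contraTT isT => xj'.
  by have := @entry_neq0 _ x j' (Ordinal jk) i (leqnSn _) xj'; rewrite xj eqxx.
move=> l lj; apply/eqP; apply: contraNT xi => xl.
rewrite (@entry_le _ x l (Ordinal jk) i _ xl); last exact: ltnW.
by rewrite (@entry_le _ x l j' i _ xl).
Qed.

Lemma height_is_tail i : 0 < height x t i -> exists j : 'I_k.+1, height x t i = tail t j.
Proof.
move=> h0; have : exists j, entry x j i != o.
  apply: contrapT => h; move: h0; rewrite /height big_pred0 ?ltxx// => j.
  by apply/negbTE/negP => xj; apply: h; exists j.
move=> [j1 xj1]; 
case: (@arg_minnP _ j1 (fun j => entry x j i != o) (@nat_of_ord _) xj1) => j xj jmin.
exists j; apply: height_tail => // l lj; apply/eqP; apply: contraTT lj => xl.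
by rewrite -leqNgt; exact: jmin.
Qed.

Definition tails := [seq tail t j | j <- iota 0 k.+1].

Lemma tails_sorted : sorted >%O tails.
Proof.
rewrite /tails; apply/(sortedP 0) => i; rewrite size_map size_iota => ik.
rewrite !(nth_map 0%N) ?size_iota//; last exact: ltnW.
rewrite !nth_iota//; last exact: ltnW.
by rewrite !add0n; apply: tail_lt; rewrite ltnSn ltnW.
Qed.

Lemma mem_tails r : r \in tails <-> 0 < r /\ exists i, height x t i = r.
Proof.
split=> [/mapP[j]|[r0 [i hi]]].
  rewrite mem_iota add0n => /andP[_ jk] ->; split.
    by rewrite -(tail_max t); apply: tail_lt; rewrite jk leqnn.
  exact: (tail_height (Ordinal jk)).
have [|j hj] := @height_is_tail i; first by rewrite hi.
by rewrite -hi hj; apply: map_f; rewrite mem_iota ltn_ord.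
Qed.

End reduced_points.

(** By [mem_tails] the tails are the positive moduli of the barycenter, and a strictly decreasing
    list is determined by its members. Its length gives the dimension, its differences the weights,
    thresholding the zero patterns, and the arguments of the coordinates the phases. *)
Lemma reduced_inj k (x : nerve T k) t k' (x' : nerve T k') t' :
  reduced x t -> reduced x' t' -> barycenter x t = barycenter x' t' ->
  realization_point x t = realization_point x' t'.
Proof.
move=> red red' zz.
have hh i : height x t i = height x' t' i by rewrite !height_barycenter zz.
have TT : tails t = tails t'.
  apply: (irr_sorted_eq (leT := >%O)); 
    [|exact: ltxx|exact: tails_sorted red|exact: tails_sorted red'|].
    by move=> a b c /= ba cb; exact: lt_trans ba.
  move=> r; apply/idP/idP => [/(mem_tails red)|/(mem_tails red')] [r0 [i hi]].
    by apply/(mem_tails red'); split => //; exists i; rewrite -hh.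
  by apply/(mem_tails red); split => //; exists i; rewrite hh.
have kk : k = k' by have := congr1 size TT; rewrite !size_map !size_iota => -[].
subst k'.
have Tj j : tail t j = tail t' j.
  have [jk|jk] := ltnP j k.+1.
    have := congr1 (nth 0 ^~ j) TT.
    by rewrite /tails !(nth_map 0%N) ?size_iota// nth_iota.
  by rewrite /tail !big_pred0// => l; rewrite leqNgt (leq_trans (ltn_ord l)).
have -> : t = t'.
  apply: simplex_ext => j; apply: (addIr (tail t j.+1)).
  by rewrite -tailS Tj [in RHS]Tj -tailS.
congr realization_point; apply: nerve_ext => j; apply/val_inj/funext => i.
change (entry x j i = entry x' j i).
have [xj|xj] := eqVneq (entry x j i) o.
  apply/esym/eqP; rewrite xj -[_ == _]negbK (entry_neq0_tail red') -hh -Tj.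
  by rewrite -(entry_neq0_tail red) xj eqxx.
have xj' : entry x' j i != o.
  by rewrite (entry_neq0_tail red') -hh -Tj -(entry_neq0_tail red).
rewrite -(entry_le (_ : (j <= ord_max)%N) xj) -1?ltnS//.
rewrite -(entry_le (_ : (j <= ord_max)%N) xj') -1?ltnS//.
have m0 : entry x ord_max i != o by apply: entry_neq0 xj; rewrite -ltnS.
have m0' : entry x' ord_max i != o by apply: entry_neq0 xj'; rewrite -ltnS.
have := congr1 (@^~ i) zz; rewrite /= !barycenterE => e; apply: val_inj.
apply: unit_scale_inj e; [exact: phase_sqn|exact: phase_sqn| |exact: height_ge0].
apply: lt_le_trans (_ : tail t j <= _); last by rewrite -(entry_neq0_tail red).
by rewrite -(tail_max t); apply: (tail_lt red); rewrite ltn_ord leqnn.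
Qed.

Lemma barycenter_of_inj p q : barycenter_of p = barycenter_of q -> realization_rel p q.
Proof.
case: p => k [x t]; case: q => l [y s] e.
have [k' [x' [t' [red rel]]]] := reduce x t.
have [l' [y' [s' [red' rel']]]] := reduce y s.
apply: (realization_rel_trans rel); rewrite realization_rel_sym.
apply: (realization_rel_trans rel').
suff -> : realization_point x' t' = realization_point y' s' by exact: realization_rel_refl.
apply: reduced_inj => //.
have := barycenter_of_rel rel; have := barycenter_of_rel rel'.
by rewrite /barycenter_of /= => <- <-.
Qed.

End barycenters.

(** * Translates of disc configurations *)

Section every_boundary_config.
Context (R : realType) (n : nat).
Local Notation o := (phase0 R).
Local Notation T := (ones_perp_last1 R n.+1 : topPOrderType _).

Lemma sum_telescope (F : nat -> R) m : \sum_(j < m) (F j - F j.+1) = F 0%N - F m.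
Proof.
elim: m => [|m IH]; first by rewrite big_ord0 subrr.
by rewrite big_ord_recr/= IH; ring.
Qed.

Lemma polar_decomposition (z : R[i]) : exists f : phase R,
  z = (Num.sqrt (sqn z))%:C * val f /\ (f = o -> z = 0).
Proof.
have [->|/normalize[c c0 [v v0 zv]]] := eqVneq z 0.
  by exists o; rewrite mulr0.
exists v; split; last by move=> e; rewrite e eqxx in v0.
have -> : Num.sqrt (sqn z) = c; last exact: zv.
by rewrite zv sqnZ phase_sqn// mulr1 sqrtr_sqr gtr0_norm.
Qed.

(** A layer-cake decomposition: sort the moduli decreasingly as [A], keep in element [j] the
    coordinates of modulus at least [A j], and give it weight [A j - A j.+1]. Ties give weight 0,
    which keeps the chain length fixed. *)
Lemma barycenter_surj (z : 'I_n.+1 -> R[i]) : boundary_config z ->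
  exists (x : nerve T n) (t : simplex R n), barycenter x t = z.
Proof.
move=> [zlast z1 zpol].
have [f hf] := choice (fun i => polar_decomposition (z i)).
pose r i := Num.sqrt (sqn (z i)).
have zf i : z i = (r i)%:C * val (f i) := (hf i).1.
have r0 i : 0 <= r i by exact: sqrtr_ge0.
have r1 i : r i <= 1 by rewrite -sqrtr1 ler_sqrt.
have rlast : r ord_max = 1 by rewrite /r zlast /sqn /= expr0n expr1n addr0 sqrtr1.
pose a := sort >=%O [seq r i | i <- enum 'I_n.+1].
have sa : size a = n.+1 by rewrite size_sort size_map size_enum_ord.
have ma x : (x \in a) = (x \in [seq r i | i <- enum 'I_n.+1]) by rewrite mem_sort.
pose A j := nth 0 a j.
have Ar j : (j < n.+1)%N -> exists i, A j = r i.
  move=> jn; have : A j \in a by rewrite mem_nth ?sa.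
  by rewrite ma => /mapP[i _ ->]; exists i.
have rA i : exists2 p, (p < n.+1)%N & A p = r i.
  have ri : r i \in a by rewrite ma map_f// mem_enum.
  by exists (index (r i) a); [rewrite -sa index_mem|exact: nth_index].
have A0 j : 0 <= A j.
  have [/Ar[i ->]//|jn] := ltnP j n.+1.
  by rewrite /A nth_default// sa.
have Adecr j l : (j <= l)%N -> A l <= A j.
  move=> jl; have [ln|ln] := ltnP l n.+1; last by rewrite {1}/A nth_default ?sa.
  have : sorted >=%O a.
    by apply: sort_sorted => x y; exact: le_total.
  move=> /(sorted_leq_nth (leT := >=%O) _ _ 0) => h.
  apply: h; rewrite ?inE ?sa//; last exact: leq_ltn_trans ln.
    by move=> x y w /= xy wx; exact: le_trans xy.
  exact: lexx.
have AE0 : A 0%N = 1.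
  apply/eqP; rewrite eq_le; apply/andP; split.
    by have [i ->] := Ar 0%N isT; exact: r1.
  by have [p _ Ap] := rA ord_max; rewrite -rlast -Ap; exact: Adecr.
(* The default value of [nth] past the end of the list is the last threshold 0. *)
have An : A n.+1 = 0 by rewrite /A nth_default ?sa.
pose pt j : {ptws 'I_n.+1 -> phase R} := fun i => if A j <= r i then f i else o.
have ptX j : pt j \in ones_perp_last1 R n.+1.
  rewrite inE; apply/ones_perp_last1P; split.
    rewrite /pt rlast -AE0 Adecr//; apply: val_inj.
    by have := zf ord_max; rewrite rlast zlast mul1r => <-.
  move=> u; have [i zi di] := zpol u; exists i.
    have ri : r i = 1 by rewrite /r zi sqrtr1.
    rewrite /pt ri -AE0 Adecr//; apply/eqP => /((hf i).2) z0.
    by have := sqn1_neq0 zi; rewrite z0 eqxx.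
  have ri : r i = 1 by rewrite /r zi sqrtr1.
  by rewrite /pt ri -AE0 Adecr//; move: di; rewrite {1}zf ri mul1r.
pose xp : {ptws 'I_n.+1 -> T} := fun j => SigSub (ptX j).
have xpN : xp \in @nerve_set _ T n.
  rewrite inE => j l jl; change (pt j <= pt l)%O; apply/lefP => i; rewrite /pt.
  case: ifP => h1; first by rewrite (le_trans (Adecr _ _ jl) h1).
  by rewrite /Order.le /= /phase_le eqxx orbT.
pose w : {ptws 'I_n.+1 -> R} := fun j => A j - A j.+1.
have wS : w \in @simplex_set R n.
  rewrite inE; split=> [j|]; first by rewrite subr_ge0 Adecr.
  by rewrite /w sum_telescope AE0 An subr0.
exists (SigSub xpN), (SigSub wS); apply/funext => i.
(* Coordinate [i] is nonzero in element [j] exactly when [A j <= r i]. Otherwise, as [r i] is itself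
   a threshold, [A j.+1] is still at least [r i] and [F] does not drop. The sum telescopes to
   [r i]. *)
pose F j := Num.min (A j) (r i).
have E (j : 'I_n.+1) : (w j)%:C * val (pt j i) = (F j - F j.+1)%:C * val (f i).
  rewrite /w /pt /F; case: ifPn => h1.
    by rewrite !min_l//; apply: le_trans h1; exact: Adecr.
  rewrite -ltNge in h1; rewrite min_r ?(ltW h1)// min_r ?subrr ?mulr0 ?mul0r//.
  have [p pn Ap] := rA i; rewrite -Ap; apply: (Adecr _ _ _); rewrite ltnNge; apply/negP => pj.
  by have := Adecr _ _ pj; rewrite Ap leNgt h1.
transitivity (\sum_(j < n.+1) (F j - F j.+1)%:C * val (f i)).
  by apply: eq_bigr => j _; exact: E.
rewrite -mulr_suml -rmorph_sum sum_telescope /F AE0 An min_r// min_l//.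
by rewrite subr0 -zf.
Qed.

End every_boundary_config.

(** * Rigidity and existence of the extremal translate *)

Section translation.
Context (R : realType) (q : nat).
Implicit Types (z : 'I_q.+2 -> R[i]) (v w : 'rV[R]_(q + q)).

Lemma boundary_config_rigid z c : boundary_config z ->
  (forall i, sqn (z (lift ord_max i) + c) <= 1) -> Re c <= 0 -> c = 0.
Proof.
move=> [zlast _ pol] zc Rec; apply: sqn_eq0; apply/eqP.
rewrite eq_le sqn_ge0 andbT leNgt; apply/negP => c0.
(* At a unit [z j], staying in the disc forces [dot c (z j) <= - sqn c / 2], while this direction
   gives [dot c (z j) >= - sqn c / 4]; at the last point it gives [Re c >= sqn c / 4]. Both are
   impossible for [c != 0]. *)
have [i zi] := pol (c - (sqn c / 4)%:C); case: (unliftP ord_max i) zi => [j ->|->].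
  move=> zj; have := zc j; rewrite sqnD zj.
  have Re1 : Re (z (lift ord_max j)) <= 1.
    have : Re (z (lift ord_max j)) ^+ 2 <= 1 by rewrite -zj lerDl sqr_ge0.
    by move=> ?; nra.
  have Re2 : - 1 <= Re (z (lift ord_max j)).
    have : Re (z (lift ord_max j)) ^+ 2 <= 1 by rewrite -zj lerDl sqr_ge0.
    by move=> ?; nra.
  rewrite /dot ReD ImD ReN ImN /= mulr2n.
  move: (sqn c) c0 Re1 Re2 => S; nra.
by move=> _; rewrite zlast /dot ReD ImD ReN ImN /=; lra.
Qed.

Definition differences z : 'rV[R]_(q + q) :=
  let y j := z (lift ord_max (lift ord0 j)) - z (lift ord_max ord0) in
  row_mx (\row_j Re (y j)) (\row_j Im (y j)).

Definition point_of v (i : 'I_q.+1) : R[i] :=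
  if unlift ord0 i is Some j then v ord0 (lshift q j) +i* v ord0 (rshift q j) else 0.

Lemma point_of0 v : point_of v ord0 = 0.
Proof. by rewrite /point_of unlift_none. Qed.

Lemma point_of_lift v j :
  point_of v (lift ord0 j) = v ord0 (lshift q j) +i* v ord0 (rshift q j).
Proof. by rewrite /point_of liftK. Qed.

Lemma point_of_differences z i :
  point_of (differences z) i = z (lift ord_max i) - z (lift ord_max ord0).
Proof.
case: (unliftP ord0 i) => [j ->|->]; last by rewrite point_of0 subrr.
by rewrite point_of_lift row_mxEl row_mxEr !mxE; apply: complex_ext.
Qed.

Lemma point_of_inj v w : (forall i, point_of v i = point_of w i) -> v = w.
Proof.
move=> h; apply/rowP => k; rewrite -(splitK k); case: (fintype.split k) => j /=.
  by have := h (lift ord0 j); rewrite !point_of_lift => -[].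
by have := h (lift ord0 j); rewrite !point_of_lift => -[].
Qed.

(** Equal differences mean that one configuration is a translate of the other by [c]. According to
    the sign of [Re c], rigidity applies to one of them with [c] or to the other with [- c]. *)
Lemma differences_inj z z' : boundary_config z -> boundary_config z' ->
  differences z = differences z' -> z = z'.
Proof.
move=> bz bz' e; pose c := z' (lift ord_max ord0) - z (lift ord_max ord0).
have zc i : z' (lift ord_max i) = z (lift ord_max i) + c.
  have := point_of_differences z' i; rewrite -e point_of_differences => e'.
  by apply: (addIr (- z' (lift ord_max ord0))); rewrite -e' /c; ring.
have c0 : c = 0.
  have [Rec|Rec] := leP (Re c) 0.
    by apply: (boundary_config_rigid bz) => // i; rewrite -zc; case: bz'.
  apply: oppr_inj; rewrite oppr0.
  apply: (boundary_config_rigid bz') => [i|]; last by rewrite ReN oppr_le0 ltW.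
  by rewrite zc addrK; case: bz.
apply/funext => i; case: (unliftP ord_max i) => [j ->|->]; first by rewrite zc c0 addr0.
by case: bz bz' => [-> _ _] [-> _ _].
Qed.

Definition disc_body : set 'rV[R]_(q + q) :=
  [set v | exists c, forall i, sqn (point_of v i + c) <= 1].

Lemma differences_disc_body z : boundary_config z -> disc_body (differences z).
Proof.
move=> [_ z1 _]; exists (z (lift ord_max ord0)) => i.
by rewrite point_of_differences subrK.
Qed.

(** On the circle the negative linear term of [sqn (z + e%:C * u)] beats the quadratic one for small
    [e]; inside the disc the slack [1 - sqn z] absorbs both. *)
Lemma small_step (z u : R[i]) : sqn z <= 1 -> (sqn z = 1 -> dot u z < 0) ->
  \forall e \near (0 : R)^'+, sqn (z + e%:C * u) <= 1.
Proof.
move=> z1 zu; pose W := sqn u; have W0 : 0 <= W := sqn_ge0 u.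
have E (e : R) : sqn (z + e%:C * u) = sqn z + (e * dot u z) *+ 2 + e ^+ 2 * W.
  by rewrite sqnD sqnZ dotZr /W; congr (_ + _ *+ 2 + _); rewrite /dot; ring.
have [zlt1|] := ltP (sqn z) 1; last first.
  move=> zge1; have {}z1 : sqn z = 1 by apply/eqP; rewrite eq_le z1.
  have d0 := zu z1; near=> e.
  have e0 : 0 < e by near: e; exact: nbhs_right_gt.
  have : e < - dot u z / (W + 1).
    by near: e; apply: nbhs_right_lt; rewrite divr_gt0 ?oppr_gt0// ltr_wpDl.
  rewrite ltr_pdivlMr ?ltr_wpDl// => eW.
  have h : e * (e * (W + 1)) < e * - dot u z by rewrite ltr_pM2l.
  have h' : 0 < e * - dot u z by rewrite mulr_gt0// oppr_gt0.
  rewrite E z1 mulr2n; nra.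
pose B := `|dot u z| *+ 2 + W.
have B0 : 0 <= B by rewrite addr_ge0// mulrn_wge0.
have B1 : 0 < B + 1 by rewrite ltr_wpDl.
near=> e.
have e0 : 0 < e by near: e; exact: nbhs_right_gt.
have e1 : e < 1 by near: e; exact: nbhs_right_lt.
have : e < (1 - sqn z) / (B + 1).
  by near: e; apply: nbhs_right_lt; rewrite divr_gt0 ?subr_gt0.
rewrite ltr_pdivlMr// => eW.
have dn := ler_norm (dot u z).
rewrite E; apply: (@le_trans _ _ (sqn z + e * B)); last by nra.
have h1 : e * dot u z <= e * `|dot u z| by rewrite ler_wpM2l// ltW.
have h2 : e * (e * W) <= e * W by apply: ler_piMl; [apply: mulr_ge0 => //|]; exact: ltW.
rewrite /B !mulr2n expr2 -mulrA; lra.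
Unshelve. all: by end_near. Qed.

Lemma disc_body_differences v : disc_body v ->
  exists2 z, boundary_config z & differences z = v.
Proof.
move=> [c0 hc0].
pose g (p : R * R) : R[i] := p.1 +i* p.2.
pose S : set (R * R) := [set p | forall i, sqn (point_of v i + g p) <= 1].
have S0 : S !=set0 by exists (Re c0, Im c0) => i; rewrite /g /=; case: c0 hc0.
have cS : compact S.
  apply: (@subclosed_compact _ _ (`[(-1 : R), 1]%classic `*` `[(-1 : R), 1]%classic)).
  - have -> : S = \bigcap_(i in [set: 'I_q.+1])
        (fun p => sqn (point_of v i + g p)) @^-1` [set r | r <= 1].
      by apply/seteqP; split=> p /= h i; [move=> _|]; apply: h.
    apply: closed_bigI => i _; apply: preimage_closed; last exact: closed_le.
    move=> p _; apply: (@continuous_comp _ _ _ (fun p => point_of v i + g p) (@sqn R));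
      last exact: sqn_continuous.
    apply: complex_continuous => {}p.
      rewrite (_ : (fun _ => _) = fun p : R * R => Re (point_of v i) + p.1); last first.
        by apply/funext => ?; rewrite ReD.
      exact: (cvgD (cvg_cst _) cvg_fst).
    rewrite (_ : (fun _ => _) = fun p : R * R => Im (point_of v i) + p.2); last first.
      by apply/funext => ?; rewrite ImD.
    exact: (cvgD (cvg_cst _) cvg_snd).
  - by apply: compact_setX; exact: segment_compact.
  (* Index [ord0] carries the point 0, so an admissible translation has modulus at most 1. *)
  - move=> [a b] /(_ ord0); rewrite point_of0 add0r /sqn /= => ab.
    by split; rewrite /= in_itv/=; apply/andP; split; nra.
have cf : {within S, continuous (fun p : R * R => p.1)}.
  by apply: continuous_subspaceT => p; exact: cvg_fst.
have [p /set_mem Sp pmin] := compact_EVT_min S0 cS cf.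
pose z i := if unlift ord_max i is Some j then point_of v j + g p else 1.
have zlift j : z (lift ord_max j) = point_of v j + g p by rewrite /z liftK.
have zlast : z ord_max = 1 by rewrite /z unlift_none.
have sqn1 : sqn (1 : R[i]) = 1 by rewrite /sqn /= expr0n expr1n addr0.
exists z; last first.
  apply: point_of_inj => i; rewrite point_of_differences !zlift point_of0; ring.
split => //.
  move=> i; case: (unliftP ord_max i) => [j ->|->]; last by rewrite zlast sqn1.
  by rewrite zlift; exact: Sp.
move=> u; apply: contrapT => hu.
have {}hu i : sqn (z i) = 1 -> dot u (z i) < 0.
  by move=> zi; rewrite ltNge; apply/negP => di; apply: hu; exists i.
(* The fixed last point 1 turns a separating direction into one that lowers the real part; a small
   step along it stays admissible, against minimality. *)
have Reu : Re u < 0.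
  by have := hu ord_max; rewrite zlast sqn1 /dot /= => /(_ erefl); lra.
have : \forall e \near (0 : R)^'+, forall j, sqn (point_of v j + g p + e%:C * u) <= 1.
  apply: filter_forall => j; apply: small_step; first exact: Sp.
  by rewrite -zlift; exact: hu.
move=> /filterI/(_ (nbhs_right_gt 0))/filter_ex[e [he e0]].
have pS : (p.1 + e * Re u, p.2 + e * Im u) \in S.
  rewrite inE => j; have := he j; rewrite -addrA.
  suff -> : g p + e%:C * u = g (p.1 + e * Re u, p.2 + e * Im u) by [].
  by apply: complex_ext; rewrite ?ReD ?ImD ?ReZ ?ImZ.
have := pmin _ pS; rewrite /= lerDl pmulr_rge0//; lra.
Qed.

Lemma point_of_conv t v w i : point_of (t *: v + (1 - t) *: w) i =
  t%:C * point_of v i + (1 - t)%:C * point_of w i.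
Proof.
case: (unliftP ord0 i) => [j ->|->]; last by rewrite !point_of0 !mulr0 addr0.
rewrite !point_of_lift; apply: complex_ext; rewrite ?ReD ?ImD ?ReZ ?ImZ /=.
  by rewrite !mxE.
by rewrite !mxE.
Qed.

Lemma sqn_conv t (z w : R[i]) : 0 <= t <= 1 -> sqn z <= 1 -> sqn w <= 1 ->
  sqn (t%:C * z + (1 - t)%:C * w) <= 1.
Proof.
move=> /andP[t0 t1] z1 w1; have t1' : 0 <= 1 - t by rewrite subr_ge0.
have h := sqn_ge0 (z - w).
have -> : sqn (t%:C * z + (1 - t)%:C * w) =
    t * sqn z + (1 - t) * sqn w - t * (1 - t) * sqn (z - w).
  by rewrite /sqn !ReD !ImD !ReZ !ImZ !ReN !ImN; ring.
have := mulr_ge0 (mulr_ge0 t0 t1') h; nra.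
Qed.

Lemma disc_body_convex v w (t : R) : 0 <= t <= 1 -> disc_body v -> disc_body w ->
  disc_body (t *: v + (1 - t) *: w).
Proof.
move=> t01 [c hc] [c' hc']; exists (t%:C * c + (1 - t)%:C * c') => i.
rewrite point_of_conv.
have -> : t%:C * point_of v i + (1 - t)%:C * point_of w i + (t%:C * c + (1 - t)%:C * c') =
  t%:C * (point_of v i + c) + (1 - t)%:C * (point_of w i + c') by ring.
exact: sqn_conv.
Qed.

Lemma disc_body_nbhs0 : nbhs (0 : 'rV[R]_(q + q)) disc_body.
Proof.
have h : nbhs (0 : 'rV[R]_(q + q)) [set v : 'rV[R]_(q + q) | forall j, `|v ord0 j| < 2^-1].
  suff h j : nbhs (0 : 'rV[R]_(q + q)) [set v : 'rV[R]_(q + q) | `|v ord0 j| < 2^-1].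
    exact: (@filter_forall _ _ (fun j => [set v : 'rV[R]_(q + q) | `|v ord0 j| < 2^-1]) _ _ h).
  have /cvgrPdist_lt/(_ 2^-1) := @coord_continuous R 1 (q + q) ord0 j (0 : 'rV_(q + q)).
  rewrite invr_gt0 ltr0n => /(_ isT); apply: filterS => v.
  by rewrite mxE sub0r normrN.
apply: filterS h => v hv; exists 0 => i; rewrite addr0.
case: (unliftP ord0 i) => [j ->|->]; last by rewrite point_of0 /sqn /= expr0n addr0 ler01.
rewrite point_of_lift /sqn /=.
have := hv (lshift q j); have := hv (rshift q j); rewrite !ltr_norml.
move=> /andP[? ?] /andP[? ?]; nra.
Qed.

End translation.

(** * The order complex *)

Lemma rV_continuous (R : realType) (X : topologicalType) m (f : X -> 'rV[R]_m) :
  (forall j, continuous (fun x => f x ord0 j)) -> continuous f.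
Proof.
move=> cf x; apply/cvgrPdist_lt => e e0.
suff h j : \forall y \near x, `|f x ord0 j - f y ord0 j| < e.
  have : \forall y \near x, forall j, `|f x ord0 j - f y ord0 j| < e by exact: filter_forall.
  apply: filterS => y hy; change (mx_norm (f x - f y) < e).
  rewrite mx_normrE; apply/bigmax_ltP; split => // -[i j] _ /=.
  by rewrite ord1 !mxE; exact: hy.
by have /cvgrPdist_lt := cf j x; apply.
Qed.

Section order_complex_ball.
Context (R : realType) (q : nat).
Local Notation T := (ones_perp_last1 R q.+2 : topPOrderType _).
Local Notation Delta := (order_complex R (ones_perp_last1 R q.+2)).

Lemma ones_perp_last1_type_compact : compact [set: T].
Proof. by apply: compact_set_type; exact: ones_perp_last1_compact. Qed.

Lemma pi_eq (p p' : realization_sum R T) :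
  \pi_Delta p = \pi_Delta p' <-> realization_rel p p'.
Proof.
have h := @eqmodP (realization_sum R T) (realization_equiv R T) p p'.
by split; [exact: (introT h)|exact: (elimT h)].
Qed.

(** Every point has the same barycenter as a chain of length [q.+2], hence equals its class, so
    degree [q.+1] of the nerve alone surjects onto the realization. *)
Lemma order_complex_compact : compact [set: Delta].
Proof.
pose f (p : nerve T q.+1 * simplex R q.+1) : Delta :=
  \pi_Delta (realization_point p.1 p.2).
have cf : continuous f.
  move=> p; apply: (@continuous_comp _ _ _
    (fun p : nerve T q.+1 * simplex R q.+1 => realization_point p.1 p.2) (\pi_Delta)).
    rewrite (_ : (fun _ => _) = existT (fun k => (nerve T k * simplex R k)%type) q.+1).
      exact: existT_continuous.
    by apply/funext => -[].
  exact: pi_continuous.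
have -> : [set: Delta] = f @` [set: nerve T q.+1 * simplex R q.+1].
  apply/seteqP; split => // x _; rewrite -(reprK x).
  case: (repr x) => k [y t].
  have [y' [t' e]] := barycenter_surj (barycenter_boundary y t).
  exists (y', t') => //; apply/pi_eq.
  by apply: barycenter_of_inj; exact: e.
apply: continuous_compact; first exact: continuous_subspaceT.
rewrite (_ : setT = [set: nerve T q.+1] `*` [set: simplex R q.+1]); last first.
  by apply/seteqP; split.
apply: compact_setX; last exact: simplex_compact.
by apply: nerve_compact; exact: ones_perp_last1_type_compact.
Qed.

Definition coordinates (x : Delta) : 'rV[R]_(q + q) := differences (barycenter_of (repr x)).

Lemma coordinates_pi p : coordinates (\pi_Delta p) = differences (barycenter_of p).
Proof.
rewrite /coordinates; congr differences; apply: barycenter_of_rel.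
by apply/pi_eq; rewrite reprK.
Qed.

Lemma entry_continuous k j i : continuous (fun x : nerve T k => entry x j i).
Proof.
move=> x; apply: (@continuous_comp _ _ _ (fun x : nerve T k => val (val x j))
  (fun f : {ptws 'I_q.+2 -> phase R} => f i)); last exact: proj_continuous.
apply: (@continuous_comp _ _ _ (fun x : nerve T k => val x j)
  (val : T -> {ptws 'I_q.+2 -> phase R})); last exact: initial_continuous.
apply: (@continuous_comp _ _ _ (val : nerve T k -> {ptws 'I_k.+1 -> T})
  (fun f : {ptws 'I_k.+1 -> T} => f j)); last exact: proj_continuous.
exact: initial_continuous.
Qed.

Lemma weight_continuous k j : continuous (fun t : simplex R k => val t j).
Proof.
move=> t; apply: (@continuous_comp _ _ _ (val : simplex R k -> {ptws 'I_k.+1 -> R})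
  (fun f : {ptws 'I_k.+1 -> R} => f j)); last exact: proj_continuous.
exact: initial_continuous.
Qed.

Lemma barycenter_sum_continuous k i (c : R[i] -> R) : continuous c ->
  continuous (fun p : nerve T k * simplex R k =>
    \sum_j val p.2 j * c (val (entry p.1 j i))).
Proof.
move=> cc p; apply: (@sum_continuous _ _ _ _ _
  (fun j (p : nerve T k * simplex R k) => val p.2 j * c (val (entry p.1 j i)))) => j.
have c1 : {for p, continuous (fun p : nerve T k * simplex R k => val p.2 j)}.
  apply: (@continuous_comp _ _ _ snd (fun t : simplex R k => val t j)).
    exact: cvg_snd.
  exact: weight_continuous.
have c2 : {for p, continuous (fun p : nerve T k * simplex R k =>
    c (val (entry p.1 j i)))}.
  apply: (@continuous_comp _ _ _ (fun p : nerve T k * simplex R k => entry p.1 j i)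
    (fun x : phase R => c (val x))).
    apply: (@continuous_comp _ _ _ fst (fun x : nerve T k => entry x j i)).
      exact: cvg_fst.
    exact: entry_continuous.
  apply: (@continuous_comp _ _ _ (val : phase R -> R[i]) c).
    exact: phase_val_continuous.
  exact: cc.
exact: (cvgM c1 c2).
Qed.

Lemma Re_barycenter_continuous k i :
  continuous (fun p : nerve T k * simplex R k => Re (barycenter p.1 p.2 i)).
Proof.
rewrite (_ : (fun _ => _) = fun p : nerve T k * simplex R k =>
    \sum_j val p.2 j * Re (val (entry p.1 j i))).
  exact: (barycenter_sum_continuous (@Re_continuous R)).
by apply/funext => p; rewrite /barycenter Re_sum; apply: eq_bigr => j _; rewrite ReZ.
Qed.

Lemma Im_barycenter_continuous k i :
  continuous (fun p : nerve T k * simplex R k => Im (barycenter p.1 p.2 i)).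
Proof.
rewrite (_ : (fun _ => _) = fun p : nerve T k * simplex R k =>
    \sum_j val p.2 j * Im (val (entry p.1 j i))).
  exact: (barycenter_sum_continuous (@Im_continuous R)).
by apply/funext => p; rewrite /barycenter Im_sum; apply: eq_bigr => j _; rewrite ImZ.
Qed.

Lemma differences_barycenter_continuous k :
  continuous (fun p : nerve T k * simplex R k => differences (barycenter p.1 p.2)).
Proof.
apply: rV_continuous => j; rewrite -(splitK j); case: (fintype.split j) => l /=.
  rewrite (_ : (fun _ => _) = fun p : nerve T k * simplex R k =>
      Re (barycenter p.1 p.2 (lift ord_max (lift ord0 l))) -
      Re (barycenter p.1 p.2 (lift ord_max ord0))).
    move=> p; have c i := @Re_barycenter_continuous k i p.
    exact: (cvgB (c (lift ord_max (lift ord0 l))) (c (lift ord_max ord0))).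
  by apply/funext => p; rewrite row_mxEl mxE ReD ReN.
  rewrite (_ : (fun _ => _) = fun p : nerve T k * simplex R k =>
      Im (barycenter p.1 p.2 (lift ord_max (lift ord0 l))) -
      Im (barycenter p.1 p.2 (lift ord_max ord0))).
    move=> p; have c i := @Im_barycenter_continuous k i p.
    exact: (cvgB (c (lift ord_max (lift ord0 l))) (c (lift ord_max ord0))).
  by apply/funext => p; rewrite row_mxEr mxE ImD ImN.
Qed.

Lemma coordinates_continuous : continuous coordinates.
Proof.
apply/quotient_continuous => -[k p] U; rewrite /= coordinates_pi => nU.
have h : nbhs p ((fun p => differences (barycenter p.1 p.2)) @^-1` U).
  exact: differences_barycenter_continuous nU.
have := @existT_nbhs _ (fun k => (nerve T k * simplex R k)%type) k p _ h.
apply: filterS => _ [p' Up' <-].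
by rewrite /= coordinates_pi.
Qed.

Lemma barycenter_of_boundary (p : realization_sum R T) : boundary_config (barycenter_of p).
Proof. exact: barycenter_boundary. Qed.

Lemma coordinates_inj : injective coordinates.
Proof.
move=> x y /(differences_inj (barycenter_of_boundary _) (barycenter_of_boundary _)).
by move=> /barycenter_of_inj h; rewrite -(reprK x) -(reprK y); apply/pi_eq.
Qed.

Lemma coordinates_range : range coordinates = @disc_body R q.
Proof.
apply/seteqP; split => [_ [x _ <-]|v].
  exact/differences_disc_body/barycenter_of_boundary.
move=> /disc_body_differences[z /barycenter_surj[x [t xt]] <-].
by exists (\pi_Delta (realization_point x t)) => //; rewrite coordinates_pi /barycenter_of xt.
Qed.

Lemma order_complex_ball : homeomorphic Delta (unit_ball R (q + q)).
Proof.
(* Compactness of the body comes from the realization, of which it is a continuous image. *)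
have cK : compact (@disc_body R q).
  rewrite -coordinates_range; apply: continuous_compact order_complex_compact.
  exact/continuous_subspaceT/coordinates_continuous.
apply: homeomorphic_trans (convex_body_ball cK (@disc_body_nbhs0 R q) (@disc_body_convex R q)).
have inK x : coordinates x \in @disc_body R q.
  by rewrite inE -coordinates_range; exists x.
pose f x : @disc_body R q := SigSub (inK x).
apply: (@compact_bij_homeomorphic _ _ f).
- exact: order_complex_compact.
- exact/set_type_hausdorff_space/norm_hausdorff.
- by apply: set_type_continuous; exact: coordinates_continuous.
- by move=> x y /(congr1 val)/coordinates_inj.
- move=> [v vK]; have [x _ xv] : range coordinates v.
    by rewrite coordinates_range; exact: set_mem vK.
  by exists x; exact: val_inj.
Qed.

End order_complex_ball.

Theorem theorem3p8 (R : realType) (n : nat) (hn : (3 <= n)%N) :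
  homeomorphic_ball R (2 * n - 4)%N (order_complex R (ones_perp_last1 R n)).
Proof.
case: n hn => [|[|q]]// _.
have -> : (2 * q.+2 - 4 = q + q)%N by rewrite mul2n -addnn !addnS !addSn !subSS subn0.
exact: order_complex_ball.
Qed.
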